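(* Let $\mathcal W$ be a Banach space with a Schauder basis $(e_n)$ and let $\alpha<\omega_1$. Then there is a block subspace $\mathcal X=[x_n]\subseteq\mathcal W$ (with $(x_n)$ a block basis of $(e_n)$) which, with respect to its basis $(x_n)$, is either $\omega\alpha$-tight or $(\alpha+1)$-minimal.
   Context: $\omega\alpha$ denotes ordinal multiplication. For sequences $(x_i)_{i\le k},(y_i)_{i\le k}$ and $K\ge1$, $(x_i)\sim_K(y_i)$ means $\frac1K\|\sum_i a_ix_i\|\le\|\sum_i a_iy_i\|\le K\|\sum_i a_ix_i\|$ for all real $a_i$. For a basic sequence $(y_n)$ and a Banach space $\mathcal Y$, $T((y_n),\mathcal Y,K)$ is the tree of all finite sequences $(v_0,\dots,v_k)$ in $\mathcal Y$, including the empty one, with $(v_0,\dots,v_k)\sim_K(y_0,\dots,y_k)$. For a well-founded tree $T$, $\rho_T(s)=\sup\{\rho_T(t)+1:s\prec t\in T\}$ ($0$ at terminal nodes) and ${\rm rank}(T)=\sup\{\rho_T(s)+1:s\in T\}$; for ill-founded $T$, ${\rm rank}(T)=\infty>\alpha$ for all ordinals $\alpha$. ${\rm Emb}((y_n),\mathcal Y)=\sup_{K\ge1}{\rm rank}(T((y_n),\mathcal Y,K))$. A space $\mathcal X$ with Schauder basis $(x_n)$ is $\beta$-minimal if for every block basis $(z_n)$ of $(x_n)$ and every infinite-dimensional closed subspace $\mathcal Y\subseteq\mathcal X$, ${\rm Emb}((z_n),\mathcal Y)\ge\beta$. It is $\beta$-tight if for every block basis $(y_n)$ of $(x_n)$ there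 are finite intervals $I_0<I_1<\dots$ of $\mathbb N$ such that for every infinite $A\subseteq\mathbb N$, ${\rm Emb}\big((y_n),[x_n:n\notin\bigcup_{j\in A}I_j]\big)\le\beta$ ($[\cdot]$ = closed linear span). *)

(* Defs.v *)
From HB Require Import structures.
From mathcomp Require Import all_boot all_order all_algebra.
From mathcomp Require Import all_classical all_reals all_analysis.
From mathcomp Require Import Rstruct Rstruct_topology.
Set Implicit Arguments. Unset Strict Implicit. Unset Printing Implicit Defensive.
Import Order.TTheory GRing.Theory Num.Theory.
Import numFieldNormedType.Exports.
Local Open Scope classical_set_scope.
Local Open Scope ring_scope.

Notation RR := Rdefinitions.R.

(* ---------- Countable ordinals as Brouwer trees ----------
   Interpretation: |BZ| = 0, |BS a| = |a|+1, |BL f| = sup_n |f n|.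
   Every countable ordinal (alpha < omega_1) is of the form |a|. *)
Inductive cord : Type :=
| BZ : cord
| BS : cord -> cord
| BL : (nat -> cord) -> cord.

Fixpoint cord_addn (a : cord) (n : nat) : cord :=
  match n with O => a | S m => BS (cord_addn a m) end.

Fixpoint omega_mul (a : cord) : cord :=
  match a with
  | BZ => BZ
  | BS b => BL (fun n => cord_addn (omega_mul b) n)
  | BL f => BL (fun n => omega_mul (f n))
  end.

(* rho_ge T s b  <->  rho_T(s) >= |b|, where
   rho_T(s) = sup { rho_T(t)+1 : s strict initial segment of t, t in T }
   (and rho_T(s) = infinity on ill-founded parts, where it holds for all b). *)
Fixpoint rho_ge {X : Type} (T : seq X -> Prop) (s : seq X) (b : cord) : Prop :=
  match b with
  | BZ => True
  | BS c => exists u : seq X, u <> [::] /\ T (s ++ u) /\ rho_ge T (s ++ u) c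
  | BL f => forall n, rho_ge T s (f n)
  end.

(* Since rank(T) = rho_T(empty) + 1 for a nonempty tree:
   rank(T) <= |b|  <->  rho_T(empty) < |b|  <->  ~ rho_T(empty) >= |b| *)
Definition rank_le {X : Type} (T : seq X -> Prop) (b : cord) : Prop :=
  ~ rho_ge T [::] b.

Section Banach.
Variable W : normedModType RR.

Definition span (A : set W) : set W :=
  [set x | exists (n : nat) (v : 'I_n -> W) (a : 'I_n -> RR),
      (forall i, A (v i)) /\ x = \sum_(i < n) a i *: v i].

Definition cspan (A : set W) : set W := closure (span A).

Definition closed_subspace (Y : set W) : Prop :=
  closed Y /\ Y 0 /\ (forall (a : RR) x y, Y x -> Y y -> Y (a *: x + y)).

Definition infinite_dimensional (Y : set W) : Prop :=
  forall (n : nat) (v : 'I_n -> W), ~ (Y `<=` span (range v)).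

Definition schauder_basis (e : nat -> W) : Prop :=
  forall x : W, exists! a : nat -> RR,
    (fun N => \sum_(i < N) a i *: e i) @ \oo --> x.

Definition block_basis (x z : nat -> W) : Prop :=
  exists (p : nat -> nat) (c : nat -> RR), forall n,
    (p n < p n.+1)%N /\ z n = \sum_(p n <= i < p n.+1) c i *: x i /\ z n <> 0.

Definition equiv_K (K : RR) (s : seq W) (y : nat -> W) : Prop :=
  forall a : nat -> RR,
    K^-1 * `|\sum_(i < size s) a i *: nth 0 s i| <= `|\sum_(i < size s) a i *: y i|
    /\ `|\sum_(i < size s) a i *: y i| <= K * `|\sum_(i < size s) a i *: nth 0 s i|.

Definition emb_tree (y : nat -> W) (Y : set W) (K : RR) : seq W -> Prop :=
  fun s => (forall i, (i < size s)%N -> Y (nth 0 s i)) /\ equiv_K K s y.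

(* Emb((y_n),Y) >= |b|, where Emb = sup_{K>=1} rank(T((y_n),Y,K)) and
   rank(T) = rho_T(empty) + 1. *)
Fixpoint emb_ge (y : nat -> W) (Y : set W) (b : cord) : Prop :=
  match b with
  | BZ => True
  | BS c => exists K : RR, 1 <= K /\ rho_ge (emb_tree y Y K) [::] c
  | BL f => forall n, emb_ge y Y (f n)
  end.

Definition emb_le (y : nat -> W) (Y : set W) (b : cord) : Prop :=
  forall K : RR, 1 <= K -> rank_le (emb_tree y Y K) b.

Definition beta_minimal (x : nat -> W) (b : cord) : Prop :=
  forall (z : nat -> W) (Y : set W),
    block_basis x z -> closed_subspace Y -> infinite_dimensional Y ->
    Y `<=` cspan (range x) -> emb_ge z Y b.

Definition beta_tight (x : nat -> W) (b : cord) : Prop :=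
  forall y : nat -> W, block_basis x y ->
    exists l r : nat -> nat,
      (forall j, (l j <= r j)%N /\ (r j < l j.+1)%N) /\
      forall A : set nat, (forall m, exists n, (m <= n)%N /\ A n) ->
        emb_le y (cspan [set x n | n in
                    [set n | ~ exists j, A j /\ (l j <= n <= r j)%N]]) b.

End Banach.

(* Main.v *)
Require Import Defs.
From mathcomp Require Import all_boot all_order all_algebra.
From mathcomp Require Import all_classical all_reals all_analysis.
From mathcomp Require Import Rstruct Rstruct_topology.
From mathcomp Require Import ring lra.
Set Implicit Arguments. Unset Strict Implicit. Unset Printing Implicit Defensive.
Import Order.TTheory GRing.Theory Num.Theory.
Import numFieldNormedType.Exports.
Local Open Scope classical_set_scope.
Local Open Scope ring_scope.

(** Rational vectors of finite support form a countable space, on which one plays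
    games whose length is bounded by an ordinal. Consider the game in which I
    plays integers n, II finite-dimensional subspaces of the n-th tail of X and
    vectors of their sum, trying to copy a block sequence y. If I wins this game
    of length omega * alpha for all y and all constants, the answers of I to the
    first j positions give intervals witnessing tightness. Otherwise II wins
    for some y in every X; since a vector of the span of y costs finitely many
    rounds, II then wins the game of length alpha in which I plays arbitrary
    vectors of [y], hence an adversarial game in which I plays the spaces
    containing his vectors, within a subspace fixed by II. Stabilizing the
    adversarial game under passage to subspaces lets II answer in any
    prescribed subspace L. Feeding the moves of II in the first game to the
    second one as moves of I embeds y into every L, up to rank alpha. *)

(** Tightness fixes the intervals before the set A and the embedded vectors are known, and a vector
    supported outside the intervals may use every gap left so far. Hence only the new generators of
    II are pushed beyond [n], while the vector of II is taken in the whole accumulated span. For the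
    same reason everything below the first omitted interval is free for II: failure of tightness
    only yields a win of II from a position where the first [d] vectors of [x] are given. They are
    traded for multiples of comparable norm far out, at a cost that depends on [d] and the basis
    constant but not on the tail. Stabilization works because winning the adversarial game passes
    upward along inclusion modulo a tail: a win either persists in all subspaces, or fails in some
    subspace and in everything below it. The spaces by which II restricts I vary with the position,
    so the games can be coupled only inside a diagonal space lying below all of them modulo tails.
    There are countably many requirements, since vectors are rational and ordinals enter only as
    subterms of [alpha]. *)

(* The polynomial p stands for the vector \sum_i p`_i e_i. *)
Notation qvec := {poly rat}.

(** * Rational subspaces, tails, block sequences and fusion *)

Definition in_tail (n : nat) (p : qvec) : Prop := forall i, (i < n)%N -> p`_i = 0.

Inductive qspan (A : set qvec) : set qvec :=
| qspan0 : qspan A 0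
| qspanS c v w : A v -> qspan A w -> qspan A (c *: v + w).

Definition qsubspace (V : set qvec) : Prop :=
  V 0 /\ forall c v w, V v -> V w -> V (c *: v + w).

Lemma qspan_least (A V : set qvec) : qsubspace V -> A `<=` V -> qspan A `<=` V.
Proof.
move=> [V0 VS] AV v; elim=> [//|c u w Au _ Vw].
by apply: VS => //; apply: AV.
Qed.

Lemma qspan_gen (A : set qvec) : A `<=` qspan A.
Proof. by move=> v Av; rewrite -(scale1r v) -(addr0 (1 *: v)); apply/qspanS/qspan0. Qed.

Lemma qspan_subspace (A : set qvec) : qsubspace (qspan A).
Proof.
split=> [|c v w hv hw]; first exact: qspan0.
elim: hv => [|d u w' Au _ IH]; first by rewrite scaler0 add0r.
by rewrite scalerDr scalerA -addrA; apply: qspanS.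
Qed.

Lemma qspan_mono (A B : set qvec) : A `<=` B -> qspan A `<=` qspan B.
Proof. by move=> AB; apply: qspan_least; [exact: qspan_subspace | move=> v /AB /qspan_gen]. Qed.

Lemma qspanU (A B : set qvec) v : qspan (A `|` B) v ->
  exists a b, [/\ qspan A a, qspan B b & v = a + b].
Proof.
elim=> [|c u w [hu|hu] _ [a [b [ha hb ->]]]].
- by exists 0, 0; rewrite addr0; split=> //; exact: qspan0.
- by exists (c *: u + a), b; rewrite addrA; split=> //; exact: qspanS.
- by exists a, (c *: u + b); rewrite addrCA; split=> //; exact: qspanS.
Qed.

Section Subspace.
Variables (V : set qvec) (hV : qsubspace V).

Lemma qsubspaceD v w : V v -> V w -> V (v + w).
Proof. by move=> hv hw; rewrite -(scale1r v); apply hV.2. Qed.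

Lemma qsubspaceZ c v : V v -> V (c *: v).
Proof. by move=> hv; rewrite -(addr0 (c *: v)); apply hV.2 => //; apply hV.1. Qed.

Lemma qsubspaceB v w : V v -> V w -> V (v - w).
Proof. by move=> hv hw; rewrite -scaleN1r addrC; apply hV.2. Qed.

Lemma qsubspace_sum (I : Type) (r : seq I) (P : pred I) (F : I -> qvec) :
  (forall i, P i -> V (F i)) -> V (\sum_(i <- r | P i) F i).
Proof. by move=> h; apply: big_ind => //; [exact: hV.1 | exact: qsubspaceD]. Qed.
End Subspace.

Lemma in_tail_subspace n : qsubspace (in_tail n).
Proof.
split=> [i _|c v w hv hw i ltin]; first by rewrite coef0.
by rewrite coefD coefZ hv // hw // mulr0 addr0.
Qed.

Lemma in_tail_le m n p : (m <= n)%N -> in_tail n p -> in_tail m p.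
Proof. by move=> mn h i im; apply: h; exact: leq_trans im mn. Qed.

Lemma in_tail_size_eq0 n (p : qvec) : (size p <= n)%N -> in_tail n p -> p = 0.
Proof.
move=> sp h; apply/polyP=> i; rewrite coef0; case: (ltnP i n) => [/h //|ni].
by rewrite nth_default //; exact: leq_trans sp ni.
Qed.

Lemma setI_subspace (V U : set qvec) : qsubspace V -> qsubspace U -> qsubspace (V `&` U).
Proof.
by move=> [V0 VS] [U0 US]; split=> [|c v w [? ?] [? ?]]; split=> //; [exact: VS|exact: US].
Qed.

(** For spaces of finitely supported vectors this is infinite dimension, as tails have finite
    codimension; this form feeds the block constructions directly. *)
Definition big (V : set qvec) : Prop :=
  qsubspace V /\ forall n, exists v, [/\ V v, v != 0 & in_tail n v].

(** Inclusion up to a tail, the order in which a fusion lies below all of its stages. *)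
Definition almost_sub (V U : set qvec) : Prop := exists n, forall v, V v -> in_tail n v -> U v.

Lemma sub_almost_sub (V U : set qvec) : V `<=` U -> almost_sub V U.
Proof. by move=> h; exists 0%N => v /h. Qed.

Lemma almost_sub_trans (V U T : set qvec) :
  almost_sub V U -> almost_sub U T -> almost_sub V T.
Proof.
move=> [m hm] [n hn]; exists (maxn m n) => v Vv hv; apply: hn; last exact: in_tail_le (leq_maxr _ _) hv.
by apply: hm => //; exact: in_tail_le (leq_maxl _ _) hv.
Qed.

Lemma big_setI (V U : set qvec) : big V -> qsubspace U -> almost_sub V U -> big (V `&` U).
Proof.
move=> [sV hV] sU [m hm]; split; first exact: setI_subspace.
move=> n; have [v [Vv v0 tv]] := hV (maxn m n).
exists v; split=> //; last exact: in_tail_le (leq_maxr _ _) tv.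
by split=> //; apply: hm => //; exact: in_tail_le (leq_maxl _ _) tv.
Qed.

Definition block_seq (x : nat -> qvec) : Prop :=
  forall j, x j != 0 /\ in_tail (size (x j)) (x j.+1).

Lemma in_tail_size_lt n (p : qvec) : p != 0 -> in_tail n p -> (n < size p)%N.
Proof.
move=> p0 h; rewrite ltnNge; apply/negP => le.
by move/eqP: p0; apply; exact: in_tail_size_eq0 le h.
Qed.

Lemma block_seq_size_lt x : block_seq x -> forall i j, (i < j)%N -> (size (x i) < size (x j))%N.
Proof.
move=> hx i j; elim: j => // j IH; rewrite ltnS leq_eqVlt => /orP[/eqP ->|/IH h].
  by apply: in_tail_size_lt; [exact: (hx _).1 | exact: (hx _).2].
by apply: ltn_trans h _; apply: in_tail_size_lt; [exact: (hx _).1 | exact: (hx _).2].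
Qed.

Lemma block_seq_size_le x : block_seq x -> forall i j, (i <= j)%N -> (size (x i) <= size (x j))%N.
Proof. by move=> hx i j; rewrite leq_eqVlt => /orP[/eqP -> //|/(block_seq_size_lt hx)/ltnW]. Qed.

Lemma block_seq_in_tail x : block_seq x -> forall i j, (i < j)%N -> in_tail (size (x i)) (x j).
Proof.
move=> hx i [//|j]; rewrite ltnS => ij; apply: in_tail_le (hx j).2; exact: block_seq_size_le.
Qed.

Lemma block_seq_size_ge x : block_seq x -> forall j, (j < size (x j))%N.
Proof.
move=> hx; elim=> [|j IH]; first by rewrite size_poly_gt0; exact: (hx 0%N).1.
by apply: leq_ltn_trans IH _; exact: block_seq_size_lt.
Qed.

Lemma block_seq_in_tail_index x : block_seq x -> forall j, in_tail j (x j).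
Proof.
move=> hx [|j]; first by [].
by apply: in_tail_le (hx j).2; exact: block_seq_size_ge.
Qed.

(** The part of [v] on the blocks up to [k] has size at most [size (x k)], and as a difference of
    vectors of that tail it lies in the tail too; hence it vanishes. *)
Lemma block_seq_tail_span x k v : block_seq x -> qspan (range x) v -> in_tail (size (x k)) v ->
  qspan (x @` [set j | (k < j)%N]) v.
Proof.
move=> hx hv tv.
have : qspan ((x @` [set j | (j <= k)%N]) `|` (x @` [set j | (k < j)%N])) v.
  apply: qspan_mono hv => _ [j _ <-].
  by case: (leqP j k) => h; [left|right]; exists j.
move=> /qspanU[a [b [ha hb E]]].
have tb : in_tail (size (x k)) b.
  apply: qspan_least hb; first exact: in_tail_subspace.
  by move=> _ [j /= kj <-]; exact: block_seq_in_tail.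
have sa : (size a <= size (x k))%N.
  elim: ha => [|c _ w [j /= jk <-] _ IH]; first by rewrite size_poly0.
  apply: leq_trans (size_polyD _ _) _; rewrite geq_max IH andbT.
  by apply: leq_trans (size_scale_leq _ _) _; exact: block_seq_size_le.
have a0 : a = 0.
  apply: (in_tail_size_eq0 sa); have -> : a = v - b by rewrite E addrK.
  by apply: (qsubspaceB (in_tail_subspace _)).
by rewrite E a0 add0r.
Qed.

Lemma block_seq_big x : block_seq x -> big (qspan (range x)).
Proof.
move=> hx; split; first exact: qspan_subspace.
move=> n; exists (x n); split; [by apply: qspan_gen; exists n | exact: (hx n).1 |].
exact: block_seq_in_tail_index.
Qed.

(** Stage n+1 of a decreasing chain settles the property of code n, and block n is taken in stage
    n+1 beyond the preceding block. All later blocks stay in that stage, so the span is almost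
    contained in it and heredity applies. *)
Lemma fusion (I : countType) (Q : I -> set qvec -> Prop) (Z : set qvec) :
    big Z ->
    (forall i V U, big V -> big U -> almost_sub V U -> Q i U -> Q i V) ->
    (forall i V, big V -> V `<=` Z -> exists U, [/\ big U, U `<=` V & Q i U]) ->
  exists x, [/\ block_seq x, range x `<=` Z & forall i, Q i (qspan (range x))].
Proof.
move=> bZ her dense.
pose ok V := big V /\ V `<=` Z.
have : forall nV : nat * set qvec, exists U, ok nV.2 ->
    [/\ big U, U `<=` nV.2 & forall i, pickle i = nV.1 -> Q i U].
  move=> [n V]; have [[bV VZ]|nok] := pselect (ok V); last by exists V.
  case E : (unpickle n : option I) => [i|].
    have [U [bU UV qU]] := dense i V bV VZ.
    by exists U => _; split=> // i' /= h; move: E; rewrite -h pickleK => -[->].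
  by exists V => _; split=> // i' /= h; move: E; rewrite -h pickleK.
move=> /choice[g gP].
have : forall Vn : set qvec * nat, exists v, big Vn.1 -> [/\ Vn.1 v, v != 0 & in_tail Vn.2 v].
  move=> [V n]; have [bV|nb] := pselect (big V); last by exists 0.
  by have [v hv] := bV.2 n; exists v.
move=> /choice[h hP].
pose V := fix V n := if n is m.+1 then g (m, V m) else Z.
have okV n : ok (V n).
  elim: n => [|n [bV VZ]]; first by split.
  by have [//|bU UV _] := gP (n, V n); split=> //; exact: subset_trans UV VZ.
have VS n : V n.+1 `<=` V n by have [|bU UV _] := gP (n, V n); first exact: okV.
have Vmono i j : (i <= j)%N -> V j `<=` V i.
  elim: j => [|j IH]; first by rewrite leqn0 => /eqP ->.
  rewrite leq_eqVlt => /orP[/eqP -> //|]; rewrite ltnS => /IH; exact: (subset_trans (VS j)).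
pose x := fix x n := if n is m.+1 then h (V m.+2, size (x m)) else h (V 1%N, 0%N).
have xV n : [/\ V n.+1 (x n), x n != 0 & in_tail (if n is m.+1 then size (x m) else 0%N) (x n)].
  case: n => [|n]; first by apply: (hP (V 1%N, 0%N)); exact: (okV _).1.
  by apply: (hP (V n.+2, size (x n))); exact: (okV _).1.
have hx : block_seq x by move=> j; split; [have [] := xV j | have [] := xV j.+1].
exists x; split=> // [_ [n _ <-]|i].
  by have [h1 _ _] := xV n; exact: (okV _).2 h1.
have [|bU _ qU] := gP (pickle i, V (pickle i)); first exact: okV.
apply: (her i _ _ (block_seq_big hx) bU _ (qU i erefl)).
exists (size (x (pickle i))) => v hv tv.
apply: qspan_least (block_seq_tail_span hx hv tv); first exact: bU.1.
move=> _ [j /= ij <-]; have [xj _ _] := xV j.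
by apply: (Vmono (pickle i).+1 j.+1) => //; exact: ltnW.
Qed.

Definition lspan (s : seq qvec) : set qvec := qspan [set f | f \in s].

Definition lsub (s : seq qvec) (V : set qvec) : Prop := forall f, f \in s -> V f.

Lemma lsub_cat s t V : lsub s V -> lsub t V -> lsub (s ++ t) V.
Proof. by move=> hs ht f; rewrite mem_cat => /orP[/hs|/ht]. Qed.

Lemma lspan_sub s V : qsubspace V -> lsub s V -> lspan s `<=` V.
Proof. by move=> sV h; apply: qspan_least. Qed.

Lemma lspan_gen s : lsub s (lspan s).
Proof. by move=> f fs; exact: qspan_gen. Qed.

Lemma lspan_catl s t : lspan s `<=` lspan (s ++ t).
Proof. by apply: qspan_mono => f /= fs; rewrite mem_cat fs. Qed.

Lemma lspan_catr s t : lspan t `<=` lspan (s ++ t).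
Proof. by apply: qspan_mono => f /= fs; rewrite mem_cat fs orbT. Qed.

Lemma lspan_cat_mono s s' t : lspan s `<=` lspan s' -> lspan (s ++ t) `<=` lspan (s' ++ t).
Proof.
move=> h; apply: lspan_sub; first exact: qspan_subspace.
by apply: lsub_cat => f hf; [apply/lspan_catl/h/lspan_gen | apply/lspan_catr/lspan_gen].
Qed.

(** * Games of ordinal length *)

Section Games.
Variable leaf : nat -> seq qvec -> seq qvec -> Prop.

(* Winning condition of player II when I plays vectors of [Y] (depending on
   the round) and an integer [n], and II extends the finite-dimensional space
   spanned by [F] inside the [n]-th tail of [X] and picks a vector in it; the
   ordinal bounds the number of rounds. *)
Fixpoint asym (Y : nat -> set qvec) (X : set qvec) (K : nat) (xi : cord)
    (F xs vs : seq qvec) : Prop :=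
  match xi with
  | BZ => leaf K xs vs
  | BS c => forall x n, Y (size xs) x -> exists F' v,
      [/\ lsub F' (X `&` in_tail n), lspan (F ++ F') v &
          asym Y X K c (F ++ F') (rcons xs x) (rcons vs v)]
  | BL f => forall k, asym Y X K (f k) F xs vs
  end.

(* Here II first restricts I to a subspace [Y] of [Z], inside which I extends
   the span of [E] and picks a vector; II answers as above, in the tails of [Z]. *)
Fixpoint adv (K : nat) (xi : cord) (Z : set qvec) (E F vs ws : seq qvec) : Prop :=
  match xi with
  | BZ => leaf K vs ws
  | BS c => exists Y, [/\ big Y, Y `<=` Z &
      forall E' v, lsub E' Y -> lspan (E ++ E') v ->
      forall n, exists F' w, [/\ lsub F' (Z `&` in_tail n), lspan (F ++ F') w &
        adv K c Z (E ++ E') (F ++ F') (rcons vs v) (rcons ws w)]]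
  | BL f => forall k, adv K (f k) Z E F vs ws
  end.

(** A position in the middle of a round: I has moved and II is still to answer. *)
Definition adv_resp K c (Z : set qvec) (E F vs ws : seq qvec) : Prop :=
  forall n, exists F' w, [/\ lsub F' (Z `&` in_tail n), lspan (F ++ F') w &
        adv K c Z E (F ++ F') vs (rcons ws w)].

(** II keeps the same strategy, with the restrictions cut down to [Z] and with the integers of I
    raised beyond the point where the inclusion starts to hold. *)
Lemma adv_mono K xi Z' Z : big Z' -> big Z -> almost_sub Z' Z ->
  forall E F vs ws, adv K xi Z' E F vs ws -> adv K xi Z E F vs ws.
Proof.
move=> bZ' bZ [m hm]; elim: xi => [//|c IH|f IH] E F vs ws /=; last by move=> h k; apply: IH.
move=> [Y [bY YZ h]]; exists (Y `&` Z); split=> [||E' v hE hv n].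
- by apply: big_setI => //; [exact: bZ.1 | exists m => v /YZ; exact: hm].
- by move=> v [].
have [|F' [w [hF hw hadv]]] := h E' v _ hv (maxn n m); first by move=> f /hE[].
exists F', w; split=> //; last exact: IH.
move=> f /hF[fZ' ft]; split; last exact: in_tail_le (leq_maxl _ _) ft.
by apply: hm => //; exact: in_tail_le (leq_maxr _ _) ft.
Qed.

Lemma adv_resp_mono K xi Z' Z : big Z' -> big Z -> almost_sub Z' Z ->
  forall E F vs ws, adv_resp K xi Z' E F vs ws -> adv_resp K xi Z E F vs ws.
Proof.
move=> bZ' bZ ZZ E F vs ws; have [m hm] := ZZ => h n.
have [F' [w [hF hw hadv]]] := h (maxn n m).
exists F', w; split=> //; last exact: adv_mono hadv.
move=> f /hF[fZ' ft]; split; last exact: in_tail_le (leq_maxl _ _) ft.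
by apply: hm => //; exact: in_tail_le (leq_maxr _ _) ft.
Qed.

(* Subterms of [a] are addressed by paths, hence are countably many. *)
Fixpoint subcord (a : cord) (s : seq nat) {struct s} : cord :=
  match s, a with
  | [::], _ => a
  | _ :: s', BS c => subcord c s'
  | n :: s', BL f => subcord (f n) s'
  | _ :: _, BZ => BZ
  end.

Lemma subcord_cat a s t : subcord a (s ++ t) = subcord (subcord a s) t.
Proof. by elim: s a => [//|n s IH] [|c|f] /=; rewrite ?IH //; case: t {IH}. Qed.

Lemma subcord_BS a s c : subcord a s = BS c -> subcord a (rcons s 0%N) = c.
Proof. by rewrite -cats1 subcord_cat => ->. Qed.

Lemma subcord_BL a s f k : subcord a s = BL f -> subcord a (rcons s k) = f k.
Proof. by rewrite -cats1 subcord_cat => ->. Qed.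

Definition state : countType :=
  (nat * seq nat * (seq qvec * seq qvec * seq qvec * seq qvec))%type.

Definition adv_state (a : cord) (half : bool) (i : state) (Z : set qvec) : Prop :=
  let: (K, s, (E, F, vs, ws)) := i in
  if half then adv_resp K (subcord a s) Z E F vs ws
  else adv K (subcord a s) Z E F vs ws.

Lemma adv_state_mono a b i Z' Z : big Z' -> big Z -> almost_sub Z' Z ->
  adv_state a b i Z' -> adv_state a b i Z.
Proof.
case: i b => [[K s] [[[E F] vs] ws]] [|] bZ' bZ h /=; first exact: adv_resp_mono.
exact: adv_mono.
Qed.

(** * Stabilization and diagonalization *)

Definition stable (a : cord) (X : set qvec) : Prop :=
  forall b i L, big L -> L `<=` X -> adv_state a b i X -> adv_state a b i L.

(** If a position is lost for some [L] almost inside [V], it is lost for the intersection of [L] and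
    [V] by upward monotonicity, and the requirement there is vacuous; otherwise [V] already meets
    it. Fusion handles all positions together. *)
Lemma exists_stable a : exists X, big X /\ stable a X.
Proof.
pose Q (j : bool * state) V := adv_state a j.1 j.2 V ->
  forall L, big L -> almost_sub L V -> adv_state a j.1 j.2 L.
have bT : big setT.
  split=> // n; exists ('X^n); split=> //; first by rewrite -size_poly_gt0 size_polyXn.
  by move=> i ni; rewrite coefXn ltn_eqF.
have [||x [hx _ hQ]] := @fusion (bool * state)%type Q setT bT.
- move=> j V U bV bU VU hU hV L bL LV; apply: (hU) => //.
    exact: adv_state_mono hV.
  exact: almost_sub_trans VU.
- move=> j V bV _; have [[L [bL LV nL]]|h] :=
    pselect (exists L, [/\ big L, almost_sub L V & ~ adv_state a j.1 j.2 L]).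
    exists (L `&` V); have bLV : big (L `&` V) by apply: big_setI => //; exact: bV.1.
    split=> //.
    move=> hLV; case: nL; apply: adv_state_mono hLV => //.
    by apply: sub_almost_sub => v [].
  exists V; split=> // _ L bL LV; apply: contrapT => nL.
  by apply: h; exists L.
exists (qspan (range x)); split; first exact: block_seq_big.
by move=> b i L bL LX h; apply: (hQ (b, i)) => //; exact: sub_almost_sub.
Qed.

Definition resp_space K c X E F vs ws (Y : set qvec) : Prop :=
  forall E' v, lsub E' Y -> lspan (E ++ E') v ->
    adv_resp K c X (E ++ E') F (rcons vs v) ws.

(** The restriction [Y] of II depends on the position reached; a space almost inside all of them
    allows the asymptotic game to be played before these positions are known. *)
Definition diagonal (a : cord) (X X' : set qvec) : Prop :=
  forall K s c E F vs ws, subcord a s = BS c -> adv K (BS c) X E F vs ws ->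
  exists Y, almost_sub X' Y /\ resp_space K c X E F vs ws Y.

Lemma exists_diagonal a X : big X -> stable a X ->
  exists x, [/\ block_seq x, range x `<=` X & diagonal a X (qspan (range x))].
Proof.
move=> bX sX.
pose Q (i : state) V := let: (K, s, (E, F, vs, ws)) := i in
  forall c, subcord a s = BS c -> adv K (BS c) X E F vs ws ->
  exists Y, almost_sub V Y /\ resp_space K c X E F vs ws Y.
have [||x [hx xX hQ]] := @fusion state Q X bX.
- move=> [[K s] [[[E F] vs] ws]] V U bV bU VU hU c hc hadv.
  have [Y [UY hY]] := hU c hc hadv; exists Y; split=> //; exact: almost_sub_trans UY.
- move=> [[K s] [[[E F] vs] ws]] V bV VX.
  have [[c [hc hadv]]|h] :=
    pselect (exists c, subcord a s = BS c /\ adv K (BS c) X E F vs ws); last first.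
    by exists V; split=> // c hc hadv; case: h; exists c.
  have : adv K (subcord a s) X E F vs ws -> adv K (subcord a s) V E F vs ws.
    exact: (sX false (K, s, (E, F, vs, ws)) V bV VX).
  rewrite hc => /(_ hadv)[Y [bY YV hY]].
  exists Y; split=> // c'; rewrite hc => -[<-] _; exists Y; split; first exact: sub_almost_sub.
  move=> E' v hE hv; apply: (adv_resp_mono bV bX (sub_almost_sub VX)); exact: hY.
exists x; split=> // K s c E F vs ws hc hadv.
exact: (hQ (K, s, (E, F, vs, ws)) c hc hadv).
Qed.

(** II always imposes the restriction [Y], reads only the vector of I, which stays in [Y] because
    [E] does, and answers as in the asymptotic game. *)
Lemma asym_adv Y X K xi F xs vs E : big Y -> Y `<=` X -> lsub E Y ->
  asym (fun=> Y) X K xi F xs vs -> adv K xi X E F xs vs.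
Proof.
move=> bY YX; elim: xi F xs vs E => [//|c IH|f IH] F xs vs E hE /=; last first.
  by move=> h k; exact: IH.
move=> h; exists Y; split=> // E' v hE' hv n.
have hEE : lsub (E ++ E') Y by exact: lsub_cat.
have [|F' [w [hF hw hc]]] := h v n; first exact: (lspan_sub bY.1 hEE).
by exists F', w; split=> //; exact: IH.
Qed.

(** * Coupling the two games *)

Fixpoint follow (fin : seq qvec -> seq qvec -> Prop) (Y L : set qvec) (xi : cord)
    (xs ws : seq qvec) : Prop :=
  match xi with
  | BZ => fin xs ws
  | BS c => forall x, Y x -> exists w, L w /\ follow fin Y L c (rcons xs x) (rcons ws w)
  | BL f => forall k, follow fin Y L (f k) xs ws
  end.

(* The finite-dimensional spaces produced by II in the asymptotic game are fed
   to the adversarial game as the moves of I there; by stability II may answer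
   them inside [L]. *)
Lemma asym_adv_follow fin a X X' Y L K s E F xs vs ws :
    (forall xs vs ws, leaf K xs vs -> leaf K vs ws -> fin xs ws) ->
    stable a X -> big X -> diagonal a X X' -> big L -> L `<=` X -> lsub F L ->
    asym (fun=> Y) X' K (subcord a s) E xs vs ->
    adv K (subcord a s) X E F vs ws ->
  follow fin Y L (subcord a s) xs ws.
Proof.
move=> hfin sX bX dX bL LX; move Exi: (subcord a s) => xi.
elim: xi s Exi E F xs vs ws => [|c IH|f IH] s Exi E F xs vs ws hF.
- exact: hfin.
- move=> hasym hadv x Yx.
  have [Y' [[n hn] hY']] := dX K s c E F vs ws Exi hadv.
  (* With [n] as the integer of I, the generators [E'] of II fall inside [Y'], so they are a legal
     move of I in the adversarial game. *)
  have [E' [v [hE' hv hasym']]] := hasym x n Yx.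
  have hE'Y : lsub E' Y' by move=> g /hE'[]; exact: hn.
  have := hY' E' v hE'Y hv; have Ec := subcord_BS Exi.
  (* Stability is used in mid-round, so that only the answer of II is moved into [L]; monotonicity
     then leads back to [X], the space to which diagonality of [X'] refers. *)
  have : adv_resp K (subcord a (rcons s 0%N)) X (E ++ E') F (rcons vs v) ws ->
      adv_resp K (subcord a (rcons s 0%N)) L (E ++ E') F (rcons vs v) ws.
    exact: (sX true (K, rcons s 0%N, (E ++ E', F, rcons vs v, ws)) L bL LX).
  rewrite Ec => h /h /(_ 0%N)[F' [w [hF' hw hadv']]].
  have hFF : lsub (F ++ F') L by apply: lsub_cat => // g /hF'[].
  exists w; split; first exact: (lspan_sub bL.1 hFF).
  apply: (IH _ Ec _ _ _ _ _ hFF hasym').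
  exact: (adv_mono bL bX (sub_almost_sub LX)).
- move=> hasym hadv k; apply: (IH k _ (subcord_BL k Exi)) (hasym k) (hadv k) => //.
Qed.

Lemma asym_mono Y X K xi F G xs vs : lspan F `<=` lspan G ->
  asym Y X K xi F xs vs -> asym Y X K xi G xs vs.
Proof.
elim: xi F G xs vs => [//|c IH|f IH] F G xs vs FG /= h; last by move=> k; exact: (IH k F).
move=> x n hx; have [F' [v [hF' hv hc]]] := h x n hx.
exists F', v; split=> //; first exact: (lspan_cat_mono FG).
by apply: IH hc; exact: lspan_cat_mono.
Qed.

(** * From a block sequence to its span *)

Definition comb (c : seq rat) (s : seq qvec) : qvec := \sum_(i < size c) c`_i *: s`_i.

Lemma comb_cat c s t : (size c <= size s)%N -> comb c (s ++ t) = comb c s.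
Proof.
by move=> h; apply: eq_bigr => i _; rewrite nth_cat (leq_trans _ h) // ltn_ord.
Qed.

Lemma comb_lspan c s V : qsubspace V -> lsub s V -> V (comb c s).
Proof.
move=> sV h; apply: qsubspace_sum => // i _; apply: (qsubspaceZ sV).
case: (ltnP i (size s)) => ls; first by apply: h; exact: mem_nth.
by rewrite nth_default //; exact: sV.1.
Qed.

Lemma qspan_range_comb (y : nat -> qvec) x : qspan (range y) x ->
  exists c, x = comb c (mkseq y (size c)).
Proof.
move=> hx.
have [n [c ->]] : exists n (c : nat -> rat), x = \sum_(i < n) c i *: y i.
  elim: hx => [|a u w [j _ <-] _ [n [c ->]]].
    by exists 0%N, (fun=> 0); rewrite big_ord0.
  exists (maxn j.+1 n), (fun i => (if i == j then a else 0) + (if (i < n)%N then c i else 0)).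
  under [RHS]eq_bigr do rewrite scalerDl; rewrite big_split /=; congr (_ + _).
    have ljm : (j < maxn j.+1 n)%N by rewrite leq_max leqnn.
    rewrite (bigD1 (Ordinal ljm)) //= eqxx big1 ?addr0 // => i hi.
    by rewrite ifN ?scale0r //; apply: contra hi => /eqP h; apply/eqP/val_inj.
  rewrite (big_ord_widen _ (fun i => c i *: y i) (leq_maxr j.+1 n)) big_mkcond /=.
  by apply: eq_bigr => i _; case: ifP => _ //; rewrite scale0r.
exists (mkseq c n); rewrite /comb size_mkseq; apply: eq_bigr => i _.
by rewrite !nth_mkseq.
Qed.

(** I repeats the same integer for [m] rounds, and the answers of II pool into a single extension, a
    legal answer to that integer. *)
Lemma asym_steps y X K xi m F k vs n : let H := fun i : nat => [set y i] in
  asym H X K (cord_addn xi m) F (mkseq y k) vs ->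
  exists F' vs', [/\ lsub F' (X `&` in_tail n), size vs' = m, lsub vs' (lspan (F ++ F')) &
    asym H X K xi (F ++ F') (mkseq y (k + m)) (vs ++ vs')].
Proof.
move=> H; elim: m F k vs => [|m IH] F k vs /=.
  by exists [::], [::]; rewrite !cats0 addn0; split.
move=> /(_ (y k) n); rewrite size_mkseq => /(_ erefl)[F1 [v [hF1 hv]]].
rewrite -mkseqS => /IH[F2 [vs2 [hF2 sv2 hv2 hh]]].
exists (F1 ++ F2), (v :: vs2); rewrite catA /= sv2; split=> //.
- exact: lsub_cat.
- by move=> g; rewrite inE => /orP[/eqP ->|/hv2 //]; exact: lspan_catl.
- by rewrite -cat_rcons addnS -addSn.
Qed.

(* One vector of the span of [y] costs finitely many rounds of the game on [y]:
   whence the factor omega. *)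
Lemma asym_basis_span y X K xi F k vs cs :
    (forall xs vs cs, size xs = size vs -> all (fun c => size c <= size xs)%N cs ->
       leaf K xs vs -> leaf K [seq comb c xs | c <- cs] [seq comb c vs | c <- cs]) ->
    size vs = k -> lsub vs (lspan F) -> all (fun c => size c <= k)%N cs ->
    asym (fun i => [set y i]) X K (omega_mul xi) F (mkseq y k) vs ->
  asym (fun=> qspan (range y)) X K xi F
    [seq comb c (mkseq y k) | c <- cs] [seq comb c vs | c <- cs].
Proof.
move=> hleaf; elim: xi F k vs cs => [|c IH|f IH] F k vs cs sv hvs hcs /=.
- by move=> h; apply: hleaf; rewrite ?size_mkseq ?sv.
- move=> h x n hx; have [d Ed] := qspan_range_comb hx.
  (* The limit branch is chosen after [x] is known: [size d] further rounds provide images of all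
     the basis vectors used by [x]. *)
  have [F' [vs' [hF' sv' hv' h']]] := asym_steps n (h (size d)).
  exists F', (comb d (vs ++ vs')).
  have hvv : lsub (vs ++ vs') (lspan (F ++ F')).
    by apply: lsub_cat => // g /hvs; exact: lspan_catl.
  have Ek : forall c0, (size c0 <= k)%N -> comb c0 (mkseq y k) = comb c0 (mkseq y (k + size d)).
    move=> c0 h0; rewrite /mkseq iotaD map_cat comb_cat //; by rewrite size_map size_iota.
  split=> //; first by apply: comb_lspan => //; exact: qspan_subspace.
  have -> : x = comb d (mkseq y (k + size d)).
    by rewrite Ed addnC /mkseq iotaD map_cat comb_cat // size_map size_iota.
  have -> : [seq comb c0 (mkseq y k) | c0 <- cs] = [seq comb c0 (mkseq y (k + size d)) | c0 <- cs].
    by apply/eq_in_map => c0 /(allP hcs)/Ek.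
  have -> : [seq comb c0 vs | c0 <- cs] = [seq comb c0 (vs ++ vs') | c0 <- cs].
    by apply/eq_in_map => c0 /(allP hcs) h0; rewrite comb_cat // sv.
  rewrite -!map_rcons; apply: IH => //; first by rewrite size_cat sv sv'.
  rewrite all_rcons leq_addl /=; apply: sub_all hcs => c0 /leq_trans; apply; exact: leq_addr.
- by move=> h j; apply: IH.
Qed.

End Games.

(** * Convergence with geometric rate *)

Definition conv (W : normedModType RR) (f : nat -> W) (x : W) : Prop :=
  forall eps : RR, 0 < eps -> exists N, forall n, (N <= n)%N -> `|x - f n| <= eps.

Lemma convP (W : normedModType RR) (f : nat -> W) x : f @ \oo --> x <-> conv f x.
Proof.
split=> [/cvgrPdist_le h eps e0|h]; first by have [N _ hN] := h _ e0; exists N.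
by apply/cvgrPdist_le => eps /h[N hN]; exists N.
Qed.

Lemma halfX_gt0 k : 0 < 2^-1 ^+ k :> RR. Proof. by apply: exprn_gt0; rewrite invr_gt0. Qed.

Lemma halfX_small (D eps : RR) : 0 < eps -> exists k, D * 2^-1 ^+ k <= eps.
Proof.
move=> e0; have [n hn] : exists n, D / eps <= n%:R :> RR.
  exists (Num.Def.archi_bound (D / eps)).
  have := archi_boundP (normr_ge0 (D / eps)); move=> _.
  case: (lerP 0 (D / eps)) => h; first exact/ltW/archi_boundP.
  by apply: le_trans (ltW h) _.
exists n; rewrite exprVn ler_pdivrMr ?exprn_gt0 //.
have : n%:R <= 2 ^+ n :> RR by rewrite -natrX ler_nat ltnW // ltn_expl.
move: hn; rewrite ler_pdivrMr // => hn h; apply: le_trans hn _.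
by rewrite mulrC ler_pM2l.
Qed.

Lemma le_halfX (x D B : RR) k : (forall m, (k <= m)%N -> x <= D * 2^-1 ^+ m + B) -> x <= B.
Proof.
move=> h; apply/ler_addgt0Pl => eps e0.
have [m hm] := halfX_small `|D| e0.
apply: le_trans (h (maxn k m) (leq_maxl _ _)) _; rewrite lerD2r.
apply: le_trans hm; apply: (@le_trans _ _ (`|D| * 2^-1 ^+ maxn k m)).
  by rewrite ler_pM2r ?halfX_gt0 // ler_norm.
apply: ler_wpM2l => //; apply: ler_wiXn2l; rewrite ?invr_ge0 ?leq_maxr //.
by rewrite invf_le1 // ler1n.
Qed.

(** The sequences [u k - 2 * B * 2^-1 ^+ k] and [u k + 2 * B * 2^-1 ^+ k] are monotone, increasing
    and decreasing, and bracket the limit, taken as the supremum of the lower one. *)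
Lemma geometric_limit (u : nat -> RR) (B : RR) :
    (forall k, `|u k.+1 - u k| <= B * 2^-1 ^+ k) ->
  exists l, forall k, `|l - u k| <= 2 * B * 2^-1 ^+ k.
Proof.
move=> h.
pose v k := u k - 2 * B * 2^-1 ^+ k; pose w k := u k + 2 * B * 2^-1 ^+ k.
have B0 : 0 <= B by have := h 0%N; rewrite expr0 mulr1; exact: le_trans.
have vS k : v k <= v k.+1.
  by have := h k; rewrite ler_norml /v exprS => /andP[h1 _]; lra.
have wS k : w k.+1 <= w k.
  by have := h k; rewrite ler_norml /w exprS => /andP[_ h1]; lra.
have vm i j : (i <= j)%N -> v i <= v j.
  elim: j => [|j IH]; first by rewrite leqn0 => /eqP ->.
  by rewrite leq_eqVlt => /orP[/eqP -> //|/IH h1]; exact: le_trans h1 (vS j).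
have wm i j : (i <= j)%N -> w j <= w i.
  elim: j => [|j IH]; first by rewrite leqn0 => /eqP ->.
  by rewrite leq_eqVlt => /orP[/eqP -> //|/IH h1]; exact: le_trans (wS j) h1.
have vw i j : v i <= w j.
  apply: le_trans (vm _ _ (leq_maxl i j)) (le_trans _ (wm _ _ (leq_maxr i j))).
  rewrite /v /w; have := halfX_gt0 (maxn i j); nra.
exists (sup (range v)) => k.
have h1 : v k <= sup (range v).
  apply: ub_le_sup; last by exists k.
  by exists (w 0%N) => _ [i _ <-].
have h2 : sup (range v) <= w k.
  by apply: ge_sup => [|_ [i _ <-]]; [exists (v 0%N), 0%N|].
by rewrite ler_norml; move: h1 h2; rewrite /v /w => h1 h2; apply/andP; split; lra.
Qed.

Lemma subrBB (V : zmodType) (a b c d : V) : (a - b) - (c - d) = (a - c) - (b - d).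
Proof. by rewrite !opprB addrACA [RHS]addrACA [- b - c]addrC. Qed.

Lemma closure_approx (W : normedModType RR) (A : set W) (x : W) : closure A x -> forall eps : RR, 0 < eps ->
  exists a, A a /\ `|x - a| <= eps.
Proof.
move=> hx eps e0; have := hx (ball x eps) (nbhsx_ballx x eps e0) => -[a [Aa]].
by rewrite -ball_normE /= => /ltW h; exists a.
Qed.

(** * Finiteness of the basis constant *)

Section Schauder.
Variables (W : completeNormedModType RR) (e : nat -> W) (he : schauder_basis e).

Definition coefs (w : W) : nat -> RR := sval (cid (he w)).

Definition psum (N : nat) (w : W) : W := \sum_(i < N) coefs w i *: e i.

Lemma psum_conv w : conv (psum^~ w) w.
Proof. by rewrite /psum /coefs; case: (cid _) => a /= [/convP]. Qed.

Lemma coefs_uniq w (a : nat -> RR) : conv (fun N => \sum_(i < N) a i *: e i) w -> coefs w = a.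
Proof. by rewrite /coefs => /convP h; case: (cid _) => b /= [_]; exact. Qed.

Lemma coefs_lin c v w : coefs (c *: v + w) = (fun i => c * coefs v i + coefs w i).
Proof.
apply: coefs_uniq => eps e0.
have d0 : 0 < eps / 2 / (`|c| + 1) by rewrite !divr_gt0 // ltr_wpDl.
have [N1 h1] := psum_conv v d0; have [N2 h2] := psum_conv w (divr_gt0 e0 (ltr0Sn _ 1)).
exists (maxn N1 N2) => n; rewrite geq_max => /andP[/h1 {}h1 /h2 {}h2].
have -> : \sum_(i < n) (c * coefs v i + coefs w i) *: e i = c *: psum n v + psum n w.
  rewrite /psum scaler_sumr -big_split /=; apply: eq_bigr => i _.
  by rewrite scalerDl scalerA.
rewrite opprD addrACA -scalerBr; apply: le_trans (ler_normD _ _) _; rewrite normrZ.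
have : `|c| * `|v - psum n v| <= eps / 2; last by move: h2; lra.
apply: (@le_trans _ _ ((`|c| + 1) * (eps / 2 / (`|c| + 1)))).
  by apply: ler_pM => //; rewrite lerDl.
by rewrite mulrC divfK // gt_eqF // ltr_wpDl.
Qed.

Lemma psum_lin N c v w : psum N (c *: v + w) = c *: psum N v + psum N w.
Proof.
rewrite /psum coefs_lin scaler_sumr -big_split /=; apply: eq_bigr => i _.
by rewrite scalerDl scalerA.
Qed.

Lemma coefs0 : coefs 0 = fun=> 0.
Proof.
by apply: coefs_uniq => eps e0; exists 0%N => n _;
  rewrite big1 ?subr0 ?normr0 ?ltW // => i _; rewrite scale0r.
Qed.

Lemma psum0 N : psum N 0 = 0.
Proof. by rewrite /psum coefs0 big1 // => i _; rewrite scale0r. Qed.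

Lemma psumZ N c v : psum N (c *: v) = c *: psum N v.
Proof. by rewrite -(addr0 (c *: v)) psum_lin psum0 addr0. Qed.

Lemma psumD N v w : psum N (v + w) = psum N v + psum N w.
Proof. by rewrite -{1}(scale1r v) psum_lin scale1r. Qed.

Lemma psumB N v w : psum N (v - w) = psum N v - psum N w.
Proof. by rewrite psumD -scaleN1r psumZ scaleN1r. Qed.

Lemma psum_sum N (I : Type) (r : seq I) (Q : pred I) (F : I -> W) :
  psum N (\sum_(i <- r | Q i) F i) = \sum_(i <- r | Q i) psum N (F i).
Proof. exact: (big_morph (psum N) (psumD N) (psum0 N)). Qed.

Lemma coefs_basis j : coefs (e j) = fun i => (i == j)%:R.
Proof.
apply: coefs_uniq => eps e0; exists j.+1 => n jn.
rewrite (bigD1 (Ordinal jn)) //= eqxx scale1r big1 ?addr0 ?subrr ?normr0 ?ltW // => i hi.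
by rewrite (_ : (i == j :> nat) = false) ?scale0r //; apply: contraNF hi => /eqP h; apply/eqP/val_inj.
Qed.

Lemma basis_neq0 j : e j != 0.
Proof.
apply/eqP => h; have := coefs_basis j; rewrite h coefs0 => /(congr1 (@^~ j)) /=.
by rewrite eqxx => /eqP; rewrite eq_sym oner_eq0.
Qed.

Lemma psum_bounded w : exists M : nat, forall N, `|psum N w| <= M%:R.
Proof.
have [N0 h] := psum_conv w ltr01.
pose B := `|w| + 1 + \sum_(i < N0) `|psum i w|.
exists (Num.Def.archi_bound B) => N.
have B0 : 0 <= B by rewrite addr_ge0 ?sumr_ge0 // addr_ge0.
apply: le_trans (ltW (archi_boundP B0)); rewrite /B.
case: (leqP N0 N) => hN.
  have := h N hN; have : `|psum N w| <= `|w| + `|w - psum N w|.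
    by have := ler_normB w (w - psum N w); rewrite opprB addrC subrK.
  have : 0 <= \sum_(i < N0) `|psum i w| by exact: sumr_ge0.
  lra.
rewrite (bigD1 (Ordinal hN)) //=.
have : 0 <= \sum_(i < N0 | i != Ordinal hN) `|psum i w| by exact: sumr_ge0.
have := normr_ge0 w; lra.
Qed.

Definition psum_ball (M : RR) : set W := [set x | forall N, `|psum N x| <= M].

(** Convergent expansions have bounded partial sums, so the sets [psum_ball M%:R] cover the space
    and Baire's theorem applies to the complements of their closures. *)
Lemma psum_ball_somewhere_dense : exists (M : nat) (x : W) (d : RR),
  0 < d /\ forall y, `|y - x| < d -> closure (psum_ball M%:R) y.
Proof.
apply: contrapT => hno.
pose O (M : nat) := ~` closure (psum_ball M%:R).
have hO M : open (O M) /\ dense (O M).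
  split; first by apply: closed_openC; exact: closed_closure.
  move=> U [x Ux] oU; apply: contrapT => hU; apply: hno; exists M, x.
  have := open_nbhs_nbhs (conj oU Ux); rewrite -nbhs_ballE => -[d /= d0 hd].
  exists d; split=> // y hy; apply: contrapT => ny; apply: hU; exists y.
  by split; last exact: ny; apply: hd; rewrite -ball_normE /= distrC.
have := Baire hO; move=> /(_ setT) [|//|x [_ hx]]; first by exists 0.
  exact: openT.
have [M hM] := psum_bounded x.
by apply: (hx M I); apply: subset_closure.
Qed.

(** Subtracting approximants of [x + z'] and [x] removes the centre of the ball and gives partial
    sums at most 2M; scaling back by [t = 2 * |z| / d] produces the constant 4M/d. *)
Lemma psum_approx : exists C : RR, 0 <= C /\ forall (z : W) (eps : RR), 0 < eps ->
  exists a, `|z - a| <= eps /\ psum_ball (C * `|z|) a.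
Proof.
have [M [x [d [d0 hd]]]] := psum_ball_somewhere_dense.
exists (4 * M%:R / d); split=> [|z eps e0]; first by rewrite divr_ge0 ?mulr_ge0 // ltW.
have [->|z0] := eqVneq z 0.
  by exists 0; rewrite subrr normr0 ltW //; split=> // N; rewrite psum0 normr0 mulr0.
have nz : 0 < `|z| by rewrite normr_gt0.
pose t := 2 * `|z| / d; have t0 : 0 < t by rewrite divr_gt0 // mulr_gt0.
pose z' := t^-1 *: z.
have hz' : `|z'| < d.
  rewrite normrZ gtr0_norm ?invr_gt0 //.
  have -> : t^-1 * `|z| = d / 2 by rewrite /t; field; rewrite !gt_eqF.
  by lra.
have e1 : 0 < eps / (2 * t) by rewrite divr_gt0 // mulr_gt0.
have [|a [ha hxa]] := closure_approx (hd (x + z') _) e1; first by rewrite addrAC subrr add0r.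
have [|b [hb hxb]] := closure_approx (hd x _) e1; first by rewrite subrr normr0.
exists (t *: (a - b)); split.
  have -> : z - t *: (a - b) = t *: (((x + z') - a) - (x - b)).
    rewrite subrBB [x + z' - x]addrAC subrr add0r [RHS]scalerBr /z' scalerA divff ?gt_eqF //.
    by rewrite scale1r.
  rewrite normrZ gtr0_norm //; apply: (@le_trans _ _ (t * (eps / (2 * t) + eps / (2 * t)))).
    by rewrite ler_pM2l //; apply: le_trans (ler_normB _ _) _; exact: lerD.
  by rewrite le_eqVlt; apply/orP; left; apply/eqP; field; rewrite gt_eqF.
move=> N; rewrite psumZ psumB normrZ gtr0_norm //.
have -> : 4 * M%:R / d * `|z| = t * (M%:R + M%:R).
  by rewrite /t; field; rewrite gt_eqF.
by rewrite ler_pM2l //; apply: le_trans (ler_normB _ _) _; exact: lerD.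
Qed.

(** As in the open mapping theorem, [z] is written as a series of approximants with geometrically
    small partial sums. Continuity of the coefficients is not yet known, so the coefficients of [z]
    are identified with the limits [c] through uniqueness of the expansion. *)
Theorem psum_le : exists C : RR, 1 <= C /\ forall N w, `|psum N w| <= C * `|w|.
Proof.
have [C0 [C00 hC]] := psum_approx.
suff : forall N w, `|psum N w| <= 2 * C0 * `|w|.
  move=> h; exists (2 * C0 + 1); split=> [|N w]; first by lra.
  apply: le_trans (h N w) _; rewrite ler_wpM2r //; lra.
move=> N0 z; have [->|z0] := eqVneq z 0; first by rewrite psum0 normr0 mulr0.
have nz : 0 < `|z| by rewrite normr_gt0.
have : forall rk : W * nat, exists a, `|rk.1 - a| <= `|z| * 2^-1 ^+ rk.2.+1 /\ psum_ball (C0 * `|rk.1|) a.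
  by move=> [r k]; apply: hC; rewrite mulr_gt0 ?halfX_gt0.
move=> /choice[g hg].
pose r := fix r k := if k is m.+1 then r m - g (r m, m) else z.
have hr k : `|r k| <= `|z| * 2^-1 ^+ k.
  by case: k => [|k] /=; [rewrite expr0 mulr1 | exact: (hg (r k, k)).1].
pose zk k := z - r k.
have zkS k : zk k.+1 = g (r k, k) + zk k by rewrite /zk /= opprB addrCA.
pose B := C0 * `|z|.
have B0 : 0 <= B by rewrite mulr_ge0.
have hB N k : `|psum N (zk k.+1) - psum N (zk k)| <= B * 2^-1 ^+ k.
  rewrite zkS psumD addrK; apply: le_trans ((hg (r k, k)).2 N) _ => /=.
  by rewrite /B -mulrA ler_wpM2l.
have hcoef i k : `|coefs (zk k.+1) i - coefs (zk k) i| <= 2 * B / `|e i| * 2^-1 ^+ k.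
  have ei : 0 < `|e i| by rewrite normr_gt0 basis_neq0.
  rewrite mulrAC ler_pdivlMr // -normrZ scalerBl.
  have E w : coefs w i *: e i = psum i.+1 w - psum i w by rewrite /psum big_ord_recr /= addrAC subrr add0r.
  rewrite !E.
  have := hB i.+1 k; have := hB i k.
  move=> h1 h2.
  rewrite subrBB.
  apply: le_trans (ler_normB _ _) _; lra.
have : forall i, exists l, forall k, `|l - coefs (zk k) i| <= 2 * (2 * B / `|e i|) * 2^-1 ^+ k.
  by move=> i; exact: geometric_limit.
move=> /choice[c hc].
have psumD_le N k m : `|psum N (zk (m + k)%N) - psum N (zk k)| <=
    2 * B * 2^-1 ^+ k - 2 * B * 2^-1 ^+ (m + k)%N.
  elim: m => [|m IH]; first by rewrite subrr normr0 subrr.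
  rewrite addSn -(subrKA (psum N (zk (m + k)%N))).
  apply: le_trans (ler_normD _ _) _; have := hB N (m + k)%N; rewrite exprS; lra.
(* The rate is uniform in [N], which permits the interchange of the limits in [k] and [N] below. *)
have hlim N k : `|\sum_(i < N) c i *: e i - psum N (zk k)| <= 2 * B * 2^-1 ^+ k.
  apply: (@le_halfX _ (\sum_(i < N) 2 * (2 * B / `|e i|) * `|e i|) _ k) => m km.
  rewrite -(subrKA (psum N (zk m))); apply: le_trans (ler_normD _ _) _; apply: lerD.
    rewrite /psum -sumrB mulr_suml; apply: le_trans (ler_norm_sum _ _ _) _.
    apply: ler_sum => i _; rewrite -scalerBl normrZ.
    by rewrite mulrAC ler_wpM2r.
  have := psumD_le N k (m - k)%N; rewrite subnK // => h; apply: le_trans h _.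
  by rewrite gerBl mulr_ge0 ?mulr_ge0 // ltW ?halfX_gt0.
have cE : coefs z = c.
  apply: coefs_uniq => eps e0.
  have [k hk] := halfX_small (2 * (2 * B + `|z|)) e0.
  have [N hN] := psum_conv (zk k) (divr_gt0 e0 (ltr0Sn _ 1)).
  exists N => n /hN hn; rewrite -(subrKA (zk k)).
  apply: le_trans (ler_normD _ _) _; rewrite -[X in _ + `|X|](subrKA (psum n (zk k))).
  have h1 := hlim n k; rewrite distrC in h1.
  have h2 : `|z - zk k| <= `|z| * 2^-1 ^+ k by rewrite /zk opprB addrC subrK.
  have := ler_normD (zk k - psum n (zk k)) (psum n (zk k) - \sum_(i < n) c i *: e i).
  lra.
have := hlim N0 0%N; rewrite expr0 mulr1 /zk /= subrr psum0 subr0 -cE.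
by rewrite /B mulrA.
Qed.

End Schauder.

(** * Equivalence of finite sequences and rational combinations *)

Section Combinations.
Variable W : normedModType RR.

Definition lincomb (a : nat -> RR) (s : seq W) : W := \sum_(i < size s) a i *: s`_i.

Definition equivs (K : RR) (s t : seq W) : Prop :=
  forall a, `|lincomb a s| <= K * `|lincomb a t| /\ `|lincomb a t| <= K * `|lincomb a s|.

Lemma equivs_trans K L s t u : 0 <= K -> 0 <= L ->
  equivs K s t -> equivs L t u -> equivs (K * L) s u.
Proof.
move=> K0 L0 h1 h2 a; have [h3 h4] := h1 a; have [h5 h6] := h2 a; split.
  by apply: le_trans h3 _; rewrite -mulrA ler_wpM2l.
by apply: le_trans h6 _; rewrite [K * L]mulrC -mulrA ler_wpM2l.
Qed.

Lemma equivs_le K L s t : K <= L -> equivs K s t -> equivs L s t.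
Proof.
by move=> KL h a; have [h1 h2] := h a; split; [apply: le_trans h1 _|apply: le_trans h2 _]; exact: ler_wpM2r.
Qed.

Lemma lincomb_mkseq a y k : lincomb a (mkseq y k) = \sum_(i < k) a i *: y i.
Proof. by rewrite /lincomb size_mkseq; apply: eq_bigr => i _; rewrite nth_mkseq. Qed.

Lemma lincomb_trunc_cat a s u : lincomb (fun i => if (i < size s)%N then a i else 0) (s ++ u) = lincomb a s.
Proof.
rewrite /lincomb size_cat (big_ord_widen _ (fun i => a i *: s`_i) (leq_addr (size u) _)) [RHS]big_mkcond /=.
by apply: eq_bigr => i _; rewrite nth_cat; case: ifP => // _; rewrite scale0r.
Qed.

Lemma equivs_cat K s u t w : size s = size t -> equivs K (s ++ u) (t ++ w) -> equivs K s t.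
Proof.
move=> st h a; have := h (fun i => if (i < size s)%N then a i else 0).
by rewrite lincomb_trunc_cat st lincomb_trunc_cat.
Qed.

Lemma equivs_close th s t : 0 <= th -> th <= 2^-1 -> 
  (forall a, `|lincomb a s - lincomb a t| <= th * `|lincomb a s|) -> equivs 2 s t.
Proof.
move=> t0 t1 h a; have := h a; have := ler_normD (lincomb a s - lincomb a t) (lincomb a t); rewrite subrK.
have := ler_normB (lincomb a s) (lincomb a s - lincomb a t); rewrite subKr.
have : th * `|lincomb a s| <= 2^-1 * `|lincomb a s| by exact: ler_wpM2r.
have := normr_ge0 (lincomb a s); have := normr_ge0 (lincomb a t); move=> *; split; lra.
Qed.

Lemma equiv_KP K s (y : nat -> W) : 0 < K -> equiv_K K s y <-> equivs K s (mkseq y (size s)).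
Proof.
move=> K0; split=> h a; have := h a; rewrite lincomb_mkseq => -[h1 h2]; split=> //.
  by rewrite -ler_pdivrMl.
by rewrite ler_pdivrMl.
Qed.

Lemma rat_approx (r eps : RR) : 0 < eps -> exists q : rat, `|r - ratr q| <= eps.
Proof.
move=> e0; have [|q] := @rat_in_itvoo _ (r - eps) (r + eps); first by lra.
rewrite in_itv /= => /andP[h1 h2]; exists q; rewrite ler_norml; apply/andP; split; lra.
Qed.

Lemma lin_approx (I : Type) (r : seq I) (c : I -> RR) (x : I -> W) (eps : RR) : 0 < eps ->
  exists q : I -> rat, `|\sum_(i <- r) c i *: x i - \sum_(i <- r) ratr (q i) *: x i| <= eps.
Proof.
move=> e0; pose D := \sum_(i <- r) `|x i| + 1.
have D0 : 0 < D by rewrite ltr_wpDl // sumr_ge0.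
have : forall i, exists q : rat, `|c i - ratr q| <= eps / D.
  by move=> i; apply: rat_approx; rewrite divr_gt0.
move=> /choice[q hq]; exists q.
rewrite -sumrB; apply: le_trans (ler_norm_sum _ _ _) _.
apply: (@le_trans _ _ (\sum_(i <- r) eps / D * `|x i|)).
  by apply: ler_sum => i _; rewrite -scalerBl normrZ ler_wpM2r.
rewrite -mulr_sumr -[leRHS](divfK (lt0r_neq0 D0)) ler_wpM2l //.
  by rewrite divr_ge0 // ltW.
by rewrite /D lerDl.
Qed.

Variable e : nat -> W.

Definition phi (p : qvec) : W := \sum_(i < size p) ratr p`_i *: e i.

Lemma phi_wide n (p : qvec) : (size p <= n)%N -> phi p = \sum_(i < n) ratr p`_i *: e i.
Proof.
move=> h; rewrite /phi (big_ord_widen _ (fun i => ratr p`_i *: e i) h) big_mkcond /=.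
apply: eq_bigr => i _; case: ifP => // /negbT; rewrite -leqNgt => hi.
by rewrite nth_default // rmorph0 scale0r.
Qed.

Lemma phi_lin c v w : phi (c *: v + w) = ratr c *: phi v + phi w.
Proof.
pose n := maxn (size v) (size w).
have hv : (size v <= n)%N by exact: leq_maxl.
have hw : (size w <= n)%N by exact: leq_maxr.
rewrite (phi_wide hv) (phi_wide hw) (@phi_wide n); last first.
  apply: leq_trans (size_polyD _ _) _; rewrite geq_max hw andbT.
  exact: leq_trans (size_scale_leq _ _) hv.
rewrite scaler_sumr -big_split /=; apply: eq_bigr => i _.
by rewrite coefD coefZ rmorphD rmorphM /= scalerDl scalerA.
Qed.

Lemma phi0 : phi 0 = 0. Proof. by rewrite /phi size_poly0 big_ord0. Qed.

Lemma phiD v w : phi (v + w) = phi v + phi w.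
Proof. by rewrite -{1}(scale1r v) phi_lin rmorph1 scale1r. Qed.

Lemma phiZ c v : phi (c *: v) = ratr c *: phi v.
Proof. by rewrite -(addr0 (c *: v)) phi_lin phi0 addr0. Qed.

Lemma phi_sum (I : Type) (r : seq I) (P : pred I) (F : I -> qvec) :
  phi (\sum_(i <- r | P i) F i) = \sum_(i <- r | P i) phi (F i).
Proof. exact: (big_morph phi phiD phi0). Qed.

Definition eqv (K : nat) (xs vs : seq qvec) : Prop :=
  equivs K%:R (map phi xs) (map phi vs).

Definition rcomb (c : seq rat) (s : seq W) : W := \sum_(i < size c) ratr c`_i *: s`_i.

Lemma phi_comb c s : phi (comb c s) = rcomb c (map phi s).
Proof.
rewrite /comb phi_sum; apply: eq_bigr => i _; rewrite phiZ; congr (_ *: _).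
have [h|h] := ltnP i (size s); first by rewrite (nth_map 0).
by rewrite !nth_default ?phi0 // size_map.
Qed.

(** The coefficients [b] do not depend on [s], so an equivalence between two sequences passes to all
    sequences built from them by the same combinations. *)
Lemma lincomb_map_rcomb a cs : exists b, forall s, all (fun c => size c <= size s)%N cs ->
  lincomb a [seq rcomb c s | c <- cs] = lincomb b s.
Proof.
exists (fun j => \sum_(i < size cs) a i * ratr (nth [::] cs i)`_j) => s hcs.
rewrite /lincomb size_map.
under [RHS]eq_bigr do rewrite scaler_suml.
rewrite exchange_big /=; apply: eq_bigr => i _.
rewrite (nth_map [::]) // scaler_sumr.
have hs : (size (nth [::] cs i) <= size s)%N by apply: (allP hcs); exact: mem_nth.
rewrite (big_ord_widen _ (fun j => a i *: (ratr (nth [::] cs i)`_j *: s`_j)) hs) big_mkcond /=.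
apply: eq_bigr => j _; case: ifP => [_|/negbT]; first by rewrite scalerA.
by rewrite -leqNgt => hj; rewrite [_`_j]nth_default // rmorph0 mulr0 scale0r.
Qed.

Lemma eqv_comb K xs vs cs :
  size xs = size vs -> all (fun c => size c <= size xs)%N cs -> eqv K xs vs ->
  eqv K [seq comb c xs | c <- cs] [seq comb c vs | c <- cs].
Proof.
move=> sxv hcs h a; have [b hb] := lincomb_map_rcomb a cs.
have E us : size us = size xs ->
    lincomb a (map phi [seq comb c us | c <- cs]) = lincomb b (map phi us).
  move=> sus; rewrite -hb ?size_map ?sus // -map_comp; congr (lincomb a _).
  by apply: eq_map => c; exact: phi_comb.
by rewrite !E.
Qed.

End Combinations.

(** * Perturbation of block sequences *)

Section Blocks.
Variables (W : completeNormedModType RR) (e : nat -> W) (he : schauder_basis e).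
Local Notation P := (psum he).

Lemma coefs_phi p : coefs he (phi e p) = fun i => ratr p`_i.
Proof.
apply: coefs_uniq => eps e0; exists (size p) => n hn.
by rewrite (phi_wide e hn) subrr normr0 ltW.
Qed.

Lemma phi_eq0 p : phi e p = 0 -> p = 0.
Proof.
move=> h; apply/polyP => i; have := coefs_phi p; rewrite h coefs0 => /(congr1 (@^~ i)) /esym/eqP.
by rewrite fmorph_eq0 coef0 => /eqP.
Qed.

Lemma phi_neq0 p : p != 0 -> phi e p != 0.
Proof. by apply: contra => /eqP/phi_eq0/eqP. Qed.

Lemma psum_phi_le N (p : qvec) : (size p <= N)%N -> P N (phi e p) = phi e p.
Proof. by move=> h; rewrite /psum coefs_phi (phi_wide e h). Qed.

Lemma psum_phi_in_tail N p : in_tail N p -> P N (phi e p) = 0.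
Proof.
by move=> h; rewrite /psum coefs_phi big1 // => i _; rewrite h // rmorph0 scale0r.
Qed.

(** [N m] cuts the basis between [y (m-1)] and [y m]. This form covers both rational block sequences
    and their block bases with real coefficients. *)
Definition blocked (y : nat -> W) : Prop :=
  exists N : nat -> nat, forall m n, P (N m) (y n) = if (n < m)%N then y n else 0.

Definition block_start (x : nat -> qvec) (m : nat) : nat := if m is j.+1 then size (x j) else 0%N.

Lemma psum_block_start x : block_seq x -> forall m n,
  P (block_start x m) (phi e (x n)) = if (n < m)%N then phi e (x n) else 0.
Proof.
move=> hx [|m] n /=; first by rewrite /psum big_ord0.
case: ifP => [nm|/negbT]; first by rewrite psum_phi_le //; exact: block_seq_size_le.
by rewrite -leqNgt => mn; rewrite psum_phi_in_tail //; exact: block_seq_in_tail.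
Qed.

Lemma block_seq_blocked x : block_seq x -> blocked (phi e \o x).
Proof. by move=> hx; exists (block_start x); exact: psum_block_start. Qed.

Lemma block_basis_blocked x y : block_seq x -> block_basis (phi e \o x) y -> blocked y.
Proof.
move=> hx [p [c hp]].
have pm : {homo p : i j / (i <= j)%N}.
  by apply: homo_leq => [//|? ? ?|i]; [exact: leq_trans | exact: ltnW (hp i).1].
exists (fun m => block_start x (p m)) => m n; have [_ [-> _]] := hp n.
rewrite psum_sum.
under eq_bigr do rewrite psumZ /= psum_block_start //.
case: ifP => nm.
  rewrite big_nat_cond [RHS]big_nat_cond; apply: eq_bigr => i /andP[/andP[_ h] _].
  by rewrite (leq_trans h) //; exact: pm.
rewrite big_nat_cond big1 // => i /andP[/andP[h _] _].
by rewrite ltnNge (leq_trans _ h) ?scaler0 //; apply: pm; rewrite leqNgt nm.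
Qed.

Variables (C : RR) (C1 : 1 <= C) (hC : forall N w, `|P N w| <= C * `|w|).

Lemma blocked_coef y : blocked y -> forall (a : nat -> RR) k i, (i < k)%N ->
  `|a i| * `|y i| <= 2 * C * `|\sum_(j < k) a j *: y j|.
Proof.
move=> [N hN] a k i ik; set s := \sum_(j < k) _.
have hs m : (m <= k)%N -> P (N m) s = \sum_(j < m) a j *: y j.
  move=> mk; rewrite /s psum_sum.
  rewrite (big_ord_widen k (fun j => a j *: y j) mk) [RHS]big_mkcond /=.
  by apply: eq_bigr => j _; rewrite psumZ hN; case: ifP; rewrite ?scaler0.
have -> : `|a i| * `|y i| = `|P (N i.+1) s - P (N i) s|.
  by rewrite !hs ?(ltnW ik) // big_ord_recr /= addrAC subrr add0r normrZ.
have := ler_normB (P (N i.+1) s) (P (N i) s); have := hC (N i.+1) s; have := hC (N i) s.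
lra.
Qed.

Lemma half_sum k : \sum_(i < k) (2^-1 ^+ i.+1 : RR) <= 1.
Proof.
suff : \sum_(i < k) (2^-1 ^+ i.+1 : RR) = 1 - 2^-1 ^+ k.
  by move=> ->; rewrite gerBl ltW // halfX_gt0.
elim: k => [|k IH]; first by rewrite big_ord0 expr0 subrr.
by rewrite big_ord_recr /= IH exprS; lra.
Qed.

(** A single term of a combination is bounded by [2 * C] times the norm of the combination; the
    weights compensate for this and sum so that the total relative error is at most [th]. *)
Definition small th (i : nat) : RR := th / (2 * C) * 2^-1 ^+ i.+1.

Lemma small_gt0 th i : 0 < th -> 0 < small th i.
Proof.
move=> t0; rewrite mulr_gt0 ?halfX_gt0 // divr_gt0 // mulr_gt0 //.
exact: lt_le_trans ltr01 C1.
Qed.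

Lemma small_le th i : 0 < th -> small th i <= th / 4.
Proof.
move=> t0; have c0 : 0 < C by exact: lt_le_trans ltr01 C1.
have h1 : th / (2 * C) <= th / 2.
  by rewrite ler_pM2l // lef_pV2 ?posrE ?mulr_gt0 //; move: C1; lra.
have h2 : 2^-1 ^+ i.+1 <= 2^-1 :> RR.
  rewrite exprS ger_pMr ?invr_gt0 // exprn_ile1 ?invr_ge0 // invf_le1 // ler1n //.
apply: le_trans (ler_pM _ _ h1 h2) _.
- by rewrite divr_ge0 ?mulr_ge0 // ltW.
- exact/ltW/halfX_gt0.
- lra.
Qed.

Lemma perturb y (d : nat -> W) th k (a : nat -> RR) : blocked y -> 0 <= th ->
  (forall i, (i < k)%N -> `|d i| <= small th i * `|y i|) ->
  `|\sum_(i < k) a i *: d i| <= th * `|\sum_(i < k) a i *: y i|.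
Proof.
move=> hy t0 hd; set s := \sum_(i < k) a i *: y i.
have c0 : 0 < C by exact: lt_le_trans ltr01 C1.
apply: le_trans (ler_norm_sum _ _ _) _.
apply: (@le_trans _ _ (\sum_(i < k) 2^-1 ^+ i.+1 * (th * `|s|))); last first.
  by rewrite -mulr_suml ler_piMl ?half_sum // mulr_ge0.
apply: ler_sum => i _; rewrite normrZ.
apply: le_trans (ler_wpM2l (normr_ge0 _) (hd i (ltn_ord i))) _.
rewrite mulrCA /small.
have h := blocked_coef hy a (ltn_ord i).
have -> : 2^-1 ^+ i.+1 * (th * `|s|) = th / (2 * C) * 2^-1 ^+ i.+1 * (2 * C * `|s|).
  by field; rewrite gt_eqF.
apply: ler_wpM2l => //; apply: mulr_ge0; last exact/ltW/halfX_gt0.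
by apply: divr_ge0 => //; apply: mulr_ge0 => //; exact: ltW.
Qed.

End Blocks.

(** * Trading a free initial space for vectors of the tail *)

Lemma lspan_mkseq (x : nat -> qvec) d v : lspan (mkseq x d) v ->
  exists c : nat -> rat, v = \sum_(i < d) c i *: x i.
Proof.
elim=> [|a u w /= /mapP[j]]; first by exists (fun=> 0); rewrite big1 // => i _; rewrite scale0r.
rewrite mem_iota add0n => jd -> _ [c ->].
exists (fun i => (if i == j then a else 0) + c i).
under [RHS]eq_bigr do rewrite scalerDl; rewrite big_split /=; congr (_ + _).
rewrite (bigD1 (Ordinal jd)) //= eqxx big1 ?addr0 // => i hi.
by rewrite ifN ?scale0r //; apply: contra hi => /eqP h; apply/eqP/val_inj.
Qed.

Section Shift.
Variables (W : completeNormedModType RR) (e : nat -> W) (he : schauder_basis e).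
Local Notation P := (psum he).
Local Notation phi := (phi e).
Variables (C : RR) (C1 : 1 <= C) (hC : forall N w, `|P N w| <= C * `|w|).
Variables (x : nat -> qvec) (hx : block_seq x) (d t : nat) (lam : nat -> rat).
Hypothesis lam_lb : forall i, `|phi (x i)| <= ratr (lam i) * `|phi (x (t + i)%N)|.
Hypothesis lam_ub : forall i, ratr (lam i) * `|phi (x (t + i)%N)| <= 2 * `|phi (x i)|.

(* The first [d] coordinates are moved to the positions [t], ..., [t + d - 1];
   the constant does not depend on [t]. *)
Definition shift_rel (v v' : qvec) : Prop := exists (c : nat -> rat) h,
  [/\ in_tail (block_start x (t + d)) h, v = \sum_(i < d) c i *: x i + h &
      v' = \sum_(i < d) c i *: (lam i *: x (t + i)%N) + h].

(** With heads [G], [G'] of a combination [S] before and after the shift, the norm of [G] is at most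
    [2 * C * d] times that of [S], as each term is a difference of two projections; for [G'],
    [lam_ub] costs another factor 2. Together these give the 6. *)
Definition shift_const : RR := 1 + 6 * C * d%:R.

Lemma shift_equivs (vs vs' : seq qvec) : size vs = size vs' ->
  (forall i, shift_rel vs`_i vs'`_i) -> equivs shift_const (map phi vs) (map phi vs').
Proof.
move=> svs; move=> /choice[c /choice[h hch]] a.
pose b (i : nat) := \sum_(j < size vs) a j * ratr (c j i).
pose H := \sum_(j < size vs) a j *: phi (h j).
pose G := \sum_(i < d) b i *: phi (x i).
pose G' := \sum_(i < d) b i *: (ratr (lam i) *: phi (x (t + i)%N)).
have sumE (z : nat -> qvec) (us : seq qvec) : size us = size vs ->
    (forall j, us`_j = \sum_(i < d) c j i *: z i + h j) ->
    lincomb a (map phi us) = \sum_(i < d) b i *: phi (z i) + H.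
  move=> sus hus; rewrite /lincomb size_map sus.
  under eq_bigr => j _ do rewrite (nth_map 0) ?sus // hus phiD phi_sum scalerDr scaler_sumr.
  rewrite big_split /= -/H; congr (_ + _); rewrite exchange_big /=; apply: eq_bigr => i _.
  by rewrite scaler_suml; apply: eq_bigr => j _; rewrite phiZ scalerA.
have SE : lincomb a (map phi vs) = G + H by apply: sumE => // j; have [_ ->] := hch j.
have S'E : lincomb a (map phi vs') = G' + H.
  rewrite (sumE (fun i => lam i *: x (t + i)%N)) //; last by move=> j; have [_ _ ->] := hch j.
  by congr (_ + _); apply: eq_bigr => i _; rewrite phiZ.
set S := lincomb a (map phi vs) in SE *; set S' := lincomb a (map phi vs') in S'E *.
have PH m : (m <= t + d)%N -> P (block_start x m) H = 0.
  move=> mtd; rewrite psum_sum big1 // => j _; rewrite psumZ psum_phi_in_tail ?scaler0 //.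
  have [hh _ _] := hch j; apply: in_tail_le hh; case: (m) mtd => [//|k] /=.
  case: (t + d)%N => [//|l] kl; exact: block_seq_size_le.
have hb1 (i : 'I_d) : `|b i *: phi (x i)| <= 2 * C * `|S|.
  have -> : b i *: phi (x i) = P (block_start x i.+1) S - P (block_start x i) S.
    have PG m : (m <= d)%N -> P (block_start x m) S = \sum_(j < m) b j *: phi (x j).
      move=> md; rewrite SE psumD PH ?addr0; last exact: leq_trans md (leq_addl _ _).
      rewrite psum_sum (big_ord_widen d (fun j => b j *: phi (x j)) md) [RHS]big_mkcond /=.
      by apply: eq_bigr => j _; rewrite psumZ psum_block_start //; case: ifP; rewrite ?scaler0.
    by rewrite !PG ?(ltnW (ltn_ord i)) // big_ord_recr /= addrAC subrr add0r.
  have := ler_normB (P (block_start x i.+1) S) (P (block_start x i) S); have := hC (block_start x i.+1) S.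
  have := hC (block_start x i) S; lra.
have hb2 (i : 'I_d) : `|b i *: (ratr (lam i) *: phi (x (t + i)%N))| <= 2 * C * `|S'|.
  have -> : b i *: (ratr (lam i) *: phi (x (t + i)%N)) =
      P (block_start x (t + i).+1) S' - P (block_start x (t + i)) S'.
    have PG m : (m <= d)%N -> P (block_start x (t + m)) S' =
        \sum_(j < m) b j *: (ratr (lam j) *: phi (x (t + j)%N)).
      move=> md; rewrite S'E psumD PH ?addr0 ?leq_add2l //.
      rewrite psum_sum (big_ord_widen d (fun j => b j *: (ratr (lam j) *: phi (x (t + j)%N))) md).
      rewrite [RHS]big_mkcond /=; apply: eq_bigr => j _.
      by rewrite !psumZ psum_block_start // ltn_add2l; case: ifP; rewrite ?scaler0.
    by rewrite -addnS !PG ?(ltnW (ltn_ord i)) // big_ord_recr /= addrAC subrr add0r.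
  have := ler_normB (P (block_start x (t + i).+1) S') (P (block_start x (t + i)) S').
  have := hC (block_start x (t + i).+1) S'; have := hC (block_start x (t + i)) S'; lra.
have lam0 i : 0 <= ratr (lam i) :> RR.
  have p0 : 0 < `|phi (x (t + i)%N)| by rewrite normr_gt0 (phi_neq0 he) //; exact: (hx _).1.
  by rewrite -(pmulr_lge0 _ p0); apply: le_trans (lam_lb i).
have nbl (i : 'I_d) : `|b i *: (ratr (lam i) *: phi (x (t + i)%N))| <= 2 * `|b i *: phi (x i)|.
  by rewrite !normrZ (ger0_norm (lam0 i)) [leRHS]mulrCA ler_wpM2l.
have nbu (i : 'I_d) : `|b i *: phi (x i)| <= `|b i *: (ratr (lam i) *: phi (x (t + i)%N))|.
  by rewrite !normrZ (ger0_norm (lam0 i)) ler_wpM2l.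
have bound (z : 'I_d -> W) B : (forall i, `|z i| <= B) -> `|\sum_(i < d) z i| <= d%:R * B.
  move=> hz; apply: le_trans (ler_norm_sum _ _ _) _.
  apply: (@le_trans _ _ (\sum_(i < d) B)); first exact: ler_sum.
  by rewrite sumr_const card_ord mulr_natl.
have GS : `|G| <= d%:R * (2 * C * `|S|) by exact: bound.
have G'S' : `|G'| <= d%:R * (2 * C * `|S'|) by exact: bound.
have G'S : `|G'| <= d%:R * (4 * C * `|S|).
  by apply: bound => i; apply: le_trans (nbl i) _; have := hb1 i; lra.
have GS' : `|G| <= d%:R * (2 * C * `|S'|).
  by apply: bound => i; apply: le_trans (nbu i) _.
have d0 : 0 <= d%:R :> RR by exact: ler0n.
have SS' : S = S' + (G - G') by rewrite SE S'E [RHS]addrC addrA subrK.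
have dCS : 0 <= d%:R * (C * `|S'|) by rewrite !mulr_ge0 //; apply: le_trans C1.
have := ler_normB G G'; rewrite /shift_const => h1; split.
  have := ler_normD S' (G - G'); rewrite -SS'; lra.
have -> : S' = S - (G - G') by rewrite SS' addrK.
have := ler_normB S (G - G'); lra.
Qed.

Let F0 := mkseq x d.
Let G0 := mkseq (fun i => lam i *: x (t + i)%N) d.

Lemma shift_lspan F v : lsub F (in_tail (block_start x (t + d))) -> lspan (F0 ++ F) v ->
  exists v', lspan (G0 ++ F) v' /\ shift_rel v v'.
Proof.
move=> hF hv; have : qspan ([set f | f \in F0] `|` [set f | f \in F]) v.
  by apply: qspan_mono hv => f /=; rewrite mem_cat => /orP[]; [left|right].
move=> /qspanU[a [h [/lspan_mkseq[c Ea] hh ->]]].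
exists (\sum_(i < d) c i *: (lam i *: x (t + i)%N) + h); split.
  have sG := qspan_subspace [set f | f \in G0 ++ F].
  apply: (qsubspaceD sG); last exact: lspan_catr.
  apply: (qsubspace_sum sG) => i _; apply: (qsubspaceZ sG); apply: lspan_catl; apply: qspan_gen.
  by apply/mapP; exists (val i) => //; rewrite mem_iota add0n ltn_ord.
exists c, h; rewrite Ea; split=> //.
by apply: (qspan_least _ _ hh) => //; exact: in_tail_subspace.
Qed.

Lemma shift_asym Y K K' xi F ys vs vs' : K%:R * shift_const <= K'%:R ->
    lsub F (in_tail (block_start x (t + d))) ->
    size vs = size vs' -> (forall i, shift_rel vs`_i vs'`_i) ->
  asym (eqv e) Y (qspan (range x)) K xi (F0 ++ F) ys vs ->
  asym (eqv e) Y (qspan (range x)) K' xi (G0 ++ F) ys vs'.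
Proof.
move=> hK; elim: xi F ys vs vs' => [|c IH|f IH] F ys vs vs' hF svs hvs /=.
- move=> h; apply: (equivs_le hK); apply: equivs_trans h _ => //; last exact: shift_equivs.
  by rewrite /shift_const addr_ge0 // !mulr_ge0 //; apply: le_trans C1.
- move=> h z n hz; have [F' [v [hF' hv hc]]] := h z (maxn n (block_start x (t + d))) hz.
  have hFF : lsub (F ++ F') (in_tail (block_start x (t + d))).
    by apply: lsub_cat => // g /hF'[_]; apply: in_tail_le; exact: leq_maxr.
  rewrite -catA in hv; have [v' [hv' rv]] := shift_lspan hFF hv.
  exists F', v'; rewrite -catA; split=> //.
    by move=> g /hF'[gX gt]; split=> //; apply: in_tail_le gt; exact: leq_maxl.
  apply: (IH _ _ (rcons vs v)) => //; last by rewrite catA.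
    by rewrite !size_rcons svs.
  move=> i; rewrite !nth_rcons -svs; case: ltngtP => // _.
  exists (fun=> 0), 0; split; first exact: (in_tail_subspace _).1.
    by rewrite big1 ?addr0 // => j _; rewrite scale0r.
  by rewrite big1 ?addr0 // => j _; rewrite scale0r.
- by move=> h k; exact: (IH k _ _ _ _ hF svs hvs (h k)).
Qed.

End Shift.

Section DropInitial.
Variables (W : completeNormedModType RR) (e : nat -> W) (he : schauder_basis e).

(** The replacements of the first [d] vectors are chosen after the first integer [n] of I and join
    the first answer of II. [K'] can be fixed beforehand because [shift_const] ignores how far the
    vectors are shifted. *)
Lemma asym_drop_initial x d K : block_seq x -> exists K', forall Y xi ys,
  asym (eqv e) Y (qspan (range x)) K xi (mkseq x d) ys [::] ->
  asym (eqv e) Y (qspan (range x)) K' xi [::] ys [::].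
Proof.
move=> hx; have [C [C1 hC]] := psum_le he.
have c0 : 0 <= C by exact: le_trans C1.
have B0 : 0 <= K%:R * shift_const C d by rewrite mulr_ge0 // addr_ge0 // !mulr_ge0.
exists (Num.Def.archi_bound (K%:R * shift_const C d)); set K' := Num.Def.archi_bound _.
have hK : K%:R * shift_const C d <= K'%:R by exact: ltW (archi_boundP B0).
move=> Y xi ys; elim: xi ys => [|c _|f IH] ys /=.
- move=> h; apply: equivs_le h; apply: le_trans hK.
  by rewrite -[leLHS]mulr1 ler_wpM2l // lerDl !mulr_ge0.
- move=> h z n hz.
  have : forall i, exists q : rat, `|phi e (x i)| <= ratr q * `|phi e (x (n + i)%N)| <= 2 * `|phi e (x i)|.
    move=> i; have p1 : 0 < `|phi e (x i)| by rewrite normr_gt0 (phi_neq0 he) //; exact: (hx _).1.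
    have p2 : 0 < `|phi e (x (n + i)%N)| by rewrite normr_gt0 (phi_neq0 he) //; exact: (hx _).1.
    have [|q] := @rat_in_itvoo _ (`|phi e (x i)| / `|phi e (x (n + i)%N)|)
      (2 * `|phi e (x i)| / `|phi e (x (n + i)%N)|).
      by rewrite ltr_pM2r ?invr_gt0 //; lra.
    by rewrite in_itv /= ltr_pdivrMr // ltr_pdivlMr // => /andP[/ltW h1 /ltW h2]; exists q; rewrite h1.
  move=> /choice[lam hlam].
  have hlb i : `|phi e (x i)| <= ratr (lam i) * `|phi e (x (n + i)%N)| by case/andP: (hlam i).
  have hub i : ratr (lam i) * `|phi e (x (n + i)%N)| <= 2 * `|phi e (x i)| by case/andP: (hlam i).
  (* The integer is raised beyond the shifted vectors, so that they precede all the generators of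
     II. *)
  have [F' [v [hF' hv hc]]] := h z (maxn n (block_start x (n + d))) hz.
  have hF'2 : lsub F' (in_tail (block_start x (n + d))).
    by move=> g /hF'[_]; apply: in_tail_le; exact: leq_maxr.
  have [v' [hv' rv]] := @shift_lspan x d n lam F' v hF'2 hv.
  exists (mkseq (fun i => lam i *: x (n + i)%N) d ++ F'), v'; split=> //.
    apply: lsub_cat => g; last by move=> /hF'[gX gt]; split=> //; apply: in_tail_le gt; exact: leq_maxl.
    move=> /mapP[i _ ->]; split; last first.
      apply: (qsubspaceZ (in_tail_subspace _)).
      apply: in_tail_le (@block_seq_in_tail_index x hx (n + i)%N); exact: leq_addr.
    by apply: (qsubspaceZ (qspan_subspace _)); apply: qspan_gen; exists (n + i)%N.
  apply: (shift_asym C1 hC hx hlb hub hK hF'2 _ _ hc) => //.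
  move=> [|i] //=; rewrite nth_nil; exists (fun=> 0), 0; split; first exact: (in_tail_subspace _).1.
    by rewrite big1 ?addr0 // => j _; rewrite scale0r.
  by rewrite big1 ?addr0 // => j _; rewrite scale0r.
- by move=> h k; apply: IH.
Qed.

End DropInitial.

(** * Embedding trees and winning answers of I *)

Section Trees.
Variable W : normedModType RR.

Lemma rho_ge_cat (X : Type) (T : seq X -> Prop) s u b : rho_ge T (s ++ u) b -> rho_ge T s b.
Proof.
elim: b => [//|c _|f IH] /=; last by move=> h n; exact: IH.
move=> [u' [u'0 h]]; exists (u ++ u'); rewrite catA; split=> //.
by case: (u).
Qed.

Lemma emb_tree_cat (y : nat -> W) Y K s u : 0 < K ->
  emb_tree y Y K (s ++ u) -> emb_tree y Y K s.
Proof.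
move=> K0 [hY /(equiv_KP _ _ K0) h]; split.
  move=> i hi; have := hY i; rewrite size_cat nth_cat hi; apply.
  exact: leq_trans hi (leq_addr _ _).
apply/(equiv_KP _ _ K0); move: h; rewrite size_cat /mkseq iotaD map_cat; apply: equivs_cat.
by rewrite size_map size_iota.
Qed.

(** An extension in [rho_ge] may add several vectors; the first one suffices, as the tree is closed
    under initial segments and rank only grows towards the root. *)
Lemma emb_tree_rcons (y : nat -> W) Y K s c : 0 < K ->
  rho_ge (emb_tree y Y K) s (BS c) ->
  exists v, emb_tree y Y K (rcons s v) /\ rho_ge (emb_tree y Y K) (rcons s v) c.
Proof.
move=> K0 [[|v u] [u0 [hT hr]]] //; exists v; rewrite -cat_rcons in hT hr.
by split; [exact: emb_tree_cat hT | exact: rho_ge_cat hr].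
Qed.

End Trees.

Inductive bl_sub : cord -> cord -> Prop :=
| bl_refl a : bl_sub a a
| bl_step f k b : bl_sub (f k) b -> bl_sub (BL f) b.

Lemma bl_sub_subcord a b : bl_sub a b -> exists s, b = subcord a s.
Proof. by elim=> [c|f k c _ [s ->]]; [exists [::] | exists (k :: s)]. Qed.

Lemma bl_sub_rho_ge (X : Type) (T : seq X -> Prop) s a b :
  bl_sub a b -> rho_ge T s a -> rho_ge T s b.
Proof. by elim=> [//|f k c _ IH] h; exact/IH/(h k). Qed.

Section Response.
Variables (leaf : nat -> seq qvec -> seq qvec -> Prop) (y : nat -> qvec) (X : set qvec).

Definition basis_game K xi F vs := asym leaf (fun i => [set y i]) X K xi F (mkseq y (size vs)) vs.

(* A winning answer of I: both the choices at limit ordinals and the integer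
   [n] are made in a single step. *)
Definition refutes K F vs (n : nat) (xi : cord) : Prop :=
  match xi with
  | BZ => ~ leaf K (mkseq y (size vs)) vs
  | BS c => forall F' v, lsub F' (X `&` in_tail n) -> lspan (F ++ F') v ->
      ~ basis_game K c (F ++ F') (rcons vs v)
  | BL _ => False
  end.

Lemma lost_refutes K xi F vs : ~ basis_game K xi F vs ->
  exists n xi', bl_sub xi xi' /\ refutes K F vs n xi'.
Proof.
elim: xi => [|c _|f IH] h.
- by exists 0%N, BZ; split; first exact: bl_refl.
- apply: contrapT => hn; apply: h => z n -> /=; apply: contrapT => hF; apply: hn.
  exists n, (BS c); split=> [|F' v hF' hv hg]; first exact: bl_refl.
  apply: hF; exists F', v; split=> //.
  by move: hg; rewrite /basis_game !size_rcons size_mkseq mkseqS.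
- apply: contrapT => hn; apply: h => k; apply: contrapT => /IH[n [xi' [h1 h2]]].
  by apply: hn; exists n, xi'; split=> //; exact: bl_step h1.
Qed.

End Response.

(** * Tightness from the wins of I *)

Section Tight.
Variables (W : completeNormedModType RR) (e : nat -> W) (he : schauder_basis e).
Local Notation phi := (phi e).

Lemma cspan_approx (x : nat -> qvec) (S : set nat) v (eps : RR) : 0 < eps ->
    cspan [set (phi \o x) n | n in S] v ->
  exists v', qspan (x @` S) v' /\ `|v - phi v'| <= eps.
Proof.
move=> e0 hv; have e2 : 0 < eps / 2 by exact: divr_gt0.
have [_ [[n [u [a [hu ->]]]] h1]] := closure_approx hv e2.
have : forall i, exists k, S k /\ phi (x k) = u i by move=> i; have [k Sk <-] := hu i; exists k.
move=> /choice[f hf].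
have [q hq] := lin_approx (index_enum 'I_n) a u e2.
exists (\sum_(i < n) q i *: x (f i)); split.
  apply: (qsubspace_sum (qspan_subspace _)) => i _; apply: (qsubspaceZ (qspan_subspace _)).
  by apply: qspan_gen; exists (f i) => //; exact: (hf i).1.
rewrite phi_sum; under eq_bigr => i _ do rewrite phiZ (hf i).2.
have := ler_normD (v - \sum_(i < n) a i *: u i)
  (\sum_(i < n) a i *: u i - \sum_(i < n) ratr (q i) *: u i); rewrite subrKA.
lra.
Qed.

Lemma block_basis_approx (x : nat -> qvec) y (dl : nat -> RR) : block_seq x ->
    block_basis (phi \o x) y -> (forall i, 0 < dl i <= 2^-1) ->
  exists y', [/\ block_seq y', range y' `<=` qspan (range x) &
    forall i, `|y i - phi (y' i)| <= dl i * `|y i|].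
Proof.
move=> hx [p [c hp]] hdl.
have pm : {homo p : i j / (i <= j)%N}.
  by apply: homo_leq => [//|? ? ?|i]; [exact: leq_trans | exact: ltnW (hp i).1].
have y0 i : 0 < `|y i| by rewrite normr_gt0; apply/eqP; exact: (hp i).2.2.
have : forall i, exists q : nat -> rat,
    `|y i - phi (\sum_(p i <= j < p i.+1) q j *: x j)| <= dl i * `|y i|.
  move=> i; have d0 : 0 < dl i * `|y i| by rewrite mulr_gt0 //; case/andP: (hdl i).
  have [q hq] := lin_approx (index_iota (p i) (p i.+1)) c (phi \o x) d0.
  exists q; rewrite phi_sum; under eq_bigr do rewrite phiZ.
  by rewrite {1}(hp i).2.1; exact: hq.
move=> /choice[q hq]; pose y' i := \sum_(p i <= j < p i.+1) q i j *: x j.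
have szs n : qsubspace (fun v => (size v <= n)%N).
  split=> [|a v w hv hw]; first by rewrite size_poly0.
  apply: leq_trans (size_polyD _ _) _; rewrite geq_max hw andbT.
  exact: leq_trans (size_scale_leq _ _) hv.
exists y'; split=> //.
- move=> j; split.
    apply/eqP => h; have := hq j; rewrite -/(y' j) h phi0 subr0.
    have := y0 j; have /andP[] := hdl j; nra.
  have [m pj] : exists m, p j.+1 = m.+1 by case: (p j.+1) (hp j).1 => // m _; exists m.
  have sy : (size (y' j) <= size (x m))%N.
    rewrite /y' big_nat; apply: (qsubspace_sum (szs _)) => i /andP[_ ip].
    apply: (qsubspaceZ (szs _)); apply: block_seq_size_le => //; by rewrite -ltnS -pj.
  apply: in_tail_le sy _; rewrite /y' big_nat.
  apply: (qsubspace_sum (in_tail_subspace _)) => i /andP[ip _].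
  by apply: (qsubspaceZ (in_tail_subspace _)); apply: block_seq_in_tail => //; rewrite -pj.
- move=> _ [i _ <-]; apply: (qsubspace_sum (qspan_subspace _)) => j _.
  by apply: (qsubspaceZ (qspan_subspace _)); apply: qspan_gen; exists j.
Qed.

Lemma close_equivs C th (y : nat -> W) (s t : seq W) K : 1 <= C ->
    (forall N w, `|psum he N w| <= C * `|w|) ->
    blocked he y -> 0 < K -> 0 < th -> th * K <= 2^-1 -> size t = size s ->
    equivs K (mkseq y (size s)) s ->
    (forall i, (i < size s)%N -> `|s`_i - t`_i| <= small C th i * `|y i|) ->
  equivs 2 s t.
Proof.
move=> C1 hC hy K0 th0 thK st hK hd.
apply: (@equivs_close _ (th * K)) => // [|a]; first by rewrite mulr_ge0 ?ltW.
rewrite /lincomb st -sumrB; under eq_bigr do rewrite -scalerBr.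
have /= hp := perturb (d := fun i => s`_i - t`_i) C1 hC a hy (ltW th0) hd.
apply: le_trans hp _.
by have [h _] := hK a; rewrite lincomb_mkseq in h; rewrite -mulrA ler_wpM2l // ltW.
Qed.

Lemma block_basis_approx_equivs (x : nat -> qvec) y : block_seq x -> block_basis (phi \o x) y ->
  exists y', [/\ block_seq y', range y' `<=` qspan (range x) &
    forall k, equivs 2 (mkseq y k) (mkseq (phi \o y') k)].
Proof.
move=> hx hy; have [C [C1 hC]] := psum_le he.
have h2 : 0 < 2^-1 :> RR by rewrite invr_gt0.
have [|y' [hy' yx hd]] := block_basis_approx (dl := small C 2^-1) hx hy.
  move=> i; rewrite (small_gt0 C1) //=; apply: le_trans (small_le C1 i h2) _; lra.
exists y'; split=> // k.
apply: (close_equivs C1 hC (block_basis_blocked he hx hy) ltr01 h2); rewrite ?mulr1 ?size_mkseq //.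
  by move=> a; rewrite mul1r.
by move=> i ik; rewrite !nth_mkseq //; exact: hd.
Qed.

(** An embedding tree of too large rank would let II win, by rational approximations of its nodes
    and with the [x n] of the gaps as generators. The hypothesis is asked for all [d] because the
    vectors before the first omitted interval are available from the start. *)
Theorem tight_of_lost x xi : block_seq x ->
    (forall y K d, block_seq y -> range y `<=` qspan (range x) ->
       ~ basis_game (eqv e) y (qspan (range x)) K xi (mkseq x d) [::]) ->
  beta_tight (phi \o x) xi.
Proof.
move=> hx hlost y hy; have [C [C1 hC]] := psum_le he.
have hyb := block_basis_blocked he hx hy.
have [y' [hy' y'x hyy']] := block_basis_approx_equivs hx hy.
pose X := qspan (range x).
have : forall i : (nat * seq nat * seq qvec) * seq qvec, exists n,
    let: (K, s, vs, F) := i in ~ basis_game (eqv e) y' X K (subcord xi s) F vs ->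
    exists xi', bl_sub (subcord xi s) xi' /\ refutes (eqv e) y' X K F vs n xi'.
  move=> [[[K s] vs] F].
  have [h|h] := pselect (basis_game (eqv e) y' X K (subcord xi s) F vs); first by exists 0%N.
  by have [n hn] := lost_refutes h; exists n.
move=> /choice[g hg].
(* Largest answer of I to the positions whose code is at most [j] and whose generators are among the
   first [l] vectors. All masks are tried, since the gaps depend on the set [A], not known yet. *)
pose bound (l j : nat) : nat := \max_(c < j.+1) \max_(m : l.-tuple bool)
  (if (unpickle c : option (nat * seq nat * seq qvec)%type) is Some i
   then g (i, mask m (mkseq x l)) else 0)%N.
pose l := fix l j := if j is k.+1 then (l k + bound (l k) k).+1 else 0%N.
pose r j := (l j + bound (l j) j)%N.
have lr j : (l j <= r j)%N by exact: leq_addr.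
have lS j : l j.+1 = (r j).+1 by [].
have l_mono i j : (i <= j)%N -> (l i <= l j)%N.
  elim: j => [|j IH]; first by rewrite leqn0 => /eqP ->.
  rewrite leq_eqVlt => /orP[/eqP -> //|/IH h]; rewrite lS; apply: leq_trans h _.
  exact: leq_trans (lr j) _.
have l_ge j : (j <= l j)%N by elim: j => // j IH; rewrite lS ltnS; exact: leq_trans IH (lr j).
exists l, r; split=> [j|A hA K K1 hrho]; first by rewrite lr lS ltnS leqnn.
pose S := [set n | ~ exists j, A j /\ (l j <= n <= r j)%N].
rewrite -/S in hrho; set T := emb_tree _ _ _ in hrho.
pose F j := [seq x n | n <- iota 0 (l j) & `[< S n >]].
have K0 : 0 < K by exact: lt_le_trans K1.
(* Errors are measured against [y], which is [K]-equivalent to the node [s]; relative to [s] they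
   amount to [th * K], that is 1/2. *)
pose th := (2 * K)^-1; have th0 : 0 < th by rewrite invr_gt0 mulr_gt0.
(* The factors lead from [y'] to [y], from [y] to the node, and from the node to its rational
   approximation. *)
pose K' := Num.Def.archi_bound (2 * K * 2).
have hK' : 2 * K * 2 <= K'%:R by apply/ltW/archi_boundP; rewrite !mulr_ge0 // ltW.
have F_resp j s vs : A j -> (pickle (K', s, vs) <= j)%N ->
    (g (K', s, vs, F j) <= r j)%N.
  move=> Aj hj; apply: leq_trans (leq_addl (l j) _).
  rewrite -ltnS in hj; apply: (leq_trans _ (leq_bigmax (Ordinal hj))).
  rewrite /= pickleK.
  have sm : size [seq `[< S n >] | n <- iota 0 (l j)] == l j by rewrite size_map size_iota.
  apply: (leq_trans _ (leq_bigmax (Tuple sm))) => /=.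
  by rewrite /F /mkseq -map_mask -filter_mask.
have next M m : exists j, [/\ A j, (M <= j)%N & (m < j)%N].
  have [j [h1 Aj]] := hA (maxn M m.+1); rewrite geq_max in h1.
  by case/andP: h1 => ? ?; exists j.
have claim : forall ze s vs path j, ze = subcord xi path -> size vs = size s -> T s ->
    (forall i, (i < size s)%N -> `|s`_i - phi vs`_i| <= small C th i * `|y i|) ->
    rho_ge T s ze -> A j -> (pickle (K', path, vs) <= j)%N ->
    basis_game (eqv e) y' X K' ze (F j) vs.
  (* An answer of I settles all pending limit choices at once, so one round leads from [ze] to any
     [c] with [BS c] reached through limits; the induction on [ze] is arranged accordingly. *)
  have step : forall ze, (forall c, bl_sub ze (BS c) ->
      forall s vs path j, c = subcord xi path -> size vs = size s -> T s ->
      (forall i, (i < size s)%N -> `|s`_i - phi vs`_i| <= small C th i * `|y i|) ->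
      rho_ge T s c -> A j -> (pickle (K', path, vs) <= j)%N ->
      basis_game (eqv e) y' X K' c (F j) vs) ->
    forall s vs path j, ze = subcord xi path -> size vs = size s -> T s ->
      (forall i, (i < size s)%N -> `|s`_i - phi vs`_i| <= small C th i * `|y i|) ->
      rho_ge T s ze -> A j -> (pickle (K', path, vs) <= j)%N ->
      basis_game (eqv e) y' X K' ze (F j) vs.
    move=> ze IH s vs path j Eze svs Ts hs hr Aj hj; apply: contrapT => hlo.
    rewrite Eze in hlo; have [xi' [hsub href]] := hg (K', path, vs, F j) hlo.
    have hr' := bl_sub_rho_ge hsub; rewrite -Eze in hr' hsub; move: (hr' _ _ _ hr) => {}hr'.
    case: xi' hsub href hr' => [|c|//] hsub href hr'.
      apply: href; rewrite svs; apply: (equivs_le hK').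
      have /(equiv_KP _ _ K0) hT := Ts.2.
      have hsym : equivs K (mkseq y (size s)) s by move=> a; have [? ?] := hT a.
      apply: (@equivs_trans _ (2 * K) 2 _ s); rewrite ?mulr_ge0 ?(ltW K0) //.
        apply: (@equivs_trans _ 2 K _ (mkseq y (size s))); rewrite ?(ltW K0) //.
        have -> : map phi (mkseq y' (size s)) = mkseq (phi \o y') (size s).
          by rewrite /mkseq -map_comp.
        by move=> a; have [? ?] := hyy' (size s) a.
      apply: (close_equivs C1 hC hyb K0 th0); rewrite ?size_map //.
        by rewrite /th invfM -mulrA mulVf ?mulr1 // gt_eqF.
      by move=> i hi; rewrite (nth_map 0) ?svs //; exact: hs.
    have [v [Tv hv]] := emb_tree_rcons K0 hr'.
    have vS : cspan [set (phi \o x) n | n in S] v.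
      by have := Tv.1 (size s); rewrite size_rcons nth_rcons ltnn eqxx; apply.
    have eps0 : 0 < small C th (size s) * `|y (size s)|.
      rewrite mulr_gt0 ?(small_gt0 C1) // normr_gt0; apply/eqP.
      by have [p [c0 /(_ (size s))[_ []]]] := hy.
    have [v' [hv' hvv']] := cspan_approx eps0 vS.
    have [M hM] : exists M, qspan (x @` [set n | S n /\ (n < M)%N]) v'.
      elim: hv' => [|a u w [n Sn <-] _ [M hM]]; first by exists 0%N; exact: qspan0.
      exists (maxn M n.+1); apply: qspanS; first by exists n; rewrite //= leq_max leqnn orbT.
      apply: qspan_mono hM => _ [i [Si iM] <-]; exists i => //; split=> //.
      by rewrite leq_max iM.
    have [path' Ec] := bl_sub_subcord hsub; rewrite Eze -subcord_cat in Ec.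
    have {}Ec := esym (subcord_BS (esym Ec)).
    (* The next omitted interval comes so late that the generators of [v'] precede it and that the
       code of the new position is at most [j'], hence accounted for in [r j']. *)
    have [j' [Aj' hj' jj']] := next (maxn M (pickle (K', rcons (path ++ path') 0%N, rcons vs v'))) j.
    rewrite geq_max in hj'; case/andP: hj' => hM' hp'.
    pose F' := [seq x n | n <- iota (l j) (l j' - l j) & `[< S n >]].
    have EF : F j' = F j ++ F'.
      by rewrite /F /F' -map_cat -filter_cat -{2}[l j]add0n -iotaD subnKC // l_mono // ltnW.
    apply: (href F' v').
    - move=> f /mapP[n]; rewrite mem_filter => /andP[/asboolP Sn]; rewrite mem_iota => /andP[ln _] ->.
      split; first by apply: qspan_gen; exists n.
      apply: in_tail_le (@block_seq_in_tail_index x hx n); apply: leq_trans (F_resp j path vs Aj hj) _.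
      rewrite leqNgt; apply/negP => nr; apply: Sn; exists j; split=> //.
      by rewrite ln ltnW.
    - rewrite -EF; apply: qspan_mono hM => _ [n [Sn nM] <-] /=.
      apply/mapP; exists n => //; rewrite mem_filter mem_iota add0n; apply/andP; split; first exact/asboolP.
      by apply: leq_trans nM (leq_trans hM' _).
    - rewrite -EF; apply: (IH c hsub (rcons s v) _ (rcons (path ++ path') 0%N)) => //.
        by rewrite !size_rcons svs.
      move=> i; rewrite size_rcons ltnS leq_eqVlt !nth_rcons svs => /orP[/eqP ->|hi].
        by rewrite ltnn eqxx.
      by rewrite hi; exact: hs.
  move=> ze; apply: (step); elim: ze => [|c IH|f IH] c' hc'; inversion hc'; subst.
    exact: step.
  by apply: IH; eassumption.
have [j [Aj hj _]] := next (pickle (K', [::] : seq nat, [::] : seq qvec)) 0%N.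
apply: (hlost y' K' (l j) hy' y'x).
have T0 : T [::].
  split=> // a; rewrite !big_ord0 normr0 !mulr0; split=> //.
have := claim xi [::] [::] [::] j erefl erefl T0 (fun i (hi : (i < 0)%N) => False_ind _ (notF hi)) hrho Aj hj.
rewrite /basis_game /=; apply: asym_mono.
apply: qspan_mono => f /mapP[n]; rewrite mem_filter => /andP[_ hn] ->.
by apply/mapP; exists n.
Qed.

End Tight.

(** * Minimality from copies in every subspace *)

Section InfiniteDimensional.
Variable W : normedModType RR.

(** A finite set spanning the kernel would, with one vector [v0] where [f] is nonzero, span [V]. *)
Lemma inf_dim_kernel (V : set W) (f : W -> RR) :
    (forall a v w, V v -> V w -> V (a *: v + w)) ->
    (forall a v w, f (a *: v + w) = a * f v + f w) ->
  infinite_dimensional V -> infinite_dimensional (V `&` [set w | f w = 0]).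
Proof.
move=> sV lf hV n v hv.
have [[v0 [Vv0 fv0]]|hno] := pselect (exists v0, V v0 /\ f v0 != 0); last first.
  apply: (hV n v) => w Vw; apply: hv; split=> //=; apply: contrapT => /eqP fw.
  by apply: hno; exists w.
pose v' (i : 'I_n.+1) := if unlift ord0 i is Some j then v j else v0.
apply: (hV n.+1 v') => w Vw; pose c := - (f w / f v0).
have [m [s [a [hs E]]]] : Defs.span (range v) (c *: v0 + w).
  by apply: hv; split; [exact: sV | rewrite /= lf /c mulNr divfK // addNr].
exists m.+1, (fun i => if unlift ord0 i is Some j then s j else v0),
  (fun i => if unlift ord0 i is Some j then a j else - c); split.
  move=> i; case: unliftP => [j _|_].
    by have [k _ <-] := hs j; exists (lift ord0 k) => //; rewrite /v' liftK.
  by exists ord0 => //; rewrite /v' unlift_none.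
rewrite big_ord_recl unlift_none; under eq_bigr do rewrite liftK.
by rewrite -E addrA -scalerDl addNr scale0r add0r.
Qed.

End InfiniteDimensional.

Section Minimal.
Variables (W : completeNormedModType RR) (e : nat -> W) (he : schauder_basis e).
Local Notation phi := (phi e).

Lemma inf_dim_coefs0 (V : set W) N : closed_subspace V -> infinite_dimensional V ->
  exists u, [/\ V u, u != 0 & psum he N u = 0].
Proof.
move=> [_ [V0 sV]] hV.
pose U k := V `&` [set w | forall i, (i < k)%N -> coefs he w i = 0].
have sU k a v w : U k v -> U k w -> U k (a *: v + w).
  move=> [? hv] [? hw]; split=> [|i ik]; first exact: sV.
  by rewrite coefs_lin hv // hw // mulr0 addr0.
have hU k : infinite_dimensional (U k).
  elim: k => [|k IH]; first by move=> n v hv; apply: (hV n v) => w Vw; apply: hv.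
  have := @inf_dim_kernel W (U k) (fun w => coefs he w k) (sU k) _ IH.
  move=> h n v hv; apply: (h _ n v) => [a p q|w [[Vw hw] wk]]; first by rewrite coefs_lin.
  apply: hv; split=> // i; rewrite ltnS leq_eqVlt => /orP[/eqP -> //|]; exact: hw.
apply: contrapT => hno; apply: (hU N 0%N (fun=> 0)) => w [Vw hw].
exists 0%N, (fun=> 0), (fun=> 0); split=> [[]//|]; rewrite big_ord0.
apply/eqP; apply: contrapT => /negP w0; apply: hno; exists w; split=> //.
by rewrite /psum big1 // => i _; rewrite hw // scale0r.
Qed.

Lemma almost_block_vector (b : nat -> qvec) (Y : set W) n (eps : RR) : block_seq b -> 0 < eps ->
    closed_subspace Y -> infinite_dimensional Y -> Y `<=` cspan (range (phi \o b)) ->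
  exists l u, [/\ qspan (range b) l, l != 0, in_tail n l, Y u & `|phi l - u| <= eps * `|phi l|].
Proof.
move=> hb e0 cY iY Yb; have [C [C1 hC]] := psum_le he.
have [u [Yu u0 Pu]] := inf_dim_coefs0 (size (b n)) cY iY.
have nu : 0 < `|u| by rewrite normr_gt0.
have C0 : 0 < 1 + C by move: C1; lra.
pose m := Num.min 1 eps; have m0 : 0 < m by rewrite lt_min ltr01.
(* The approximation and the dropped head cost [(1 + C) * dl], that is half of [m] times the norm of
   [u]. As [m <= 1], the norm of [phi l] is at least half that of [u], which makes the error
   relative to [phi l]. *)
pose dl := m * `|u| / 2 / (1 + C).
have dl0 : 0 < dl by rewrite !divr_gt0 // mulr_gt0.
have [g [hg hgu]] : exists g, qspan (b @` setT) g /\ `|u - phi g| <= dl.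
  by apply: cspan_approx => //; exact: Yb.
have : qspan ((b @` [set j | (j <= n)%N]) `|` (b @` [set j | (n < j)%N])) g.
  apply: qspan_mono hg => _ [j _ <-].
  by case: (leqP j n) => h; [left|right]; exists j.
move=> /qspanU[g1 [l [hg1 hl E]]].
have tll : in_tail (size (b n)) l.
  by apply: qspan_least hl; [exact: in_tail_subspace | move=> _ [j /= nj <-]; exact: block_seq_in_tail].
have sg1 : (size g1 <= size (b n))%N.
  elim: hg1 => [|c _ w [j /= jn <-] _ IH]; first by rewrite size_poly0.
  apply: leq_trans (size_polyD _ _) _; rewrite geq_max IH andbT.
  by apply: leq_trans (size_scale_leq _ _) _; exact: block_seq_size_le.
have ng1 : `|phi g1| <= C * dl.
  have -> : phi g1 = psum he (size (b n)) (phi g - u).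
    by rewrite psumB Pu subr0 E phiD psumD psum_phi_le // psum_phi_in_tail // addr0.
  apply: le_trans (hC _ _) _; apply: ler_wpM2l; first exact: le_trans C1.
  by rewrite distrC.
have nlu : `|phi l - u| <= m * `|u| / 2.
  have -> : phi l - u = (phi g - u) - phi g1 by rewrite E phiD [RHS]addrAC [phi g1 + _]addrC addrK.
  apply: le_trans (ler_normB _ _) _; rewrite distrC.
  have -> : m * `|u| / 2 = dl + C * dl by rewrite /dl; field; rewrite gt_eqF.
  exact: lerD.
have m1 : m <= 1 by rewrite ge_min lexx.
have me : m <= eps by rewrite ge_min lexx orbT.
have nl : `|u| / 2 <= `|phi l|.
  have := ler_normB (phi l) (phi l - u); rewrite subKr; nra.
exists l, u; split=> //.
- by apply: qspan_mono hl => _ [j _ <-]; exists j.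
- by apply/eqP => l0; move: nl; rewrite l0 phi0 normr0; lra.
- by apply: in_tail_le tll; exact/ltnW/block_seq_size_ge.
- apply: le_trans nlu _; rewrite -mulrA; apply: ler_pM => //; exact: ltW.
Qed.

Lemma almost_block_sequence (b : nat -> qvec) (Y : set W) (dl : nat -> RR) : block_seq b ->
    (forall i, 0 < dl i) ->
    closed_subspace Y -> infinite_dimensional Y -> Y `<=` cspan (range (phi \o b)) ->
  exists l u, [/\ block_seq l, range l `<=` qspan (range b), forall i, Y (u i) &
    forall i, `|phi (l i) - u i| <= dl i * `|phi (l i)|].
Proof.
move=> hb hdl cY iY Yb.
have : forall ni : nat * nat, exists lu : qvec * W, [/\ qspan (range b) lu.1, lu.1 != 0,
    in_tail ni.1 lu.1, Y lu.2 & `|phi lu.1 - lu.2| <= dl ni.2 * `|phi lu.1|].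
  move=> [n i]; have [l [u h]] := almost_block_vector n hb (hdl i) cY iY Yb.
  by exists (l, u).
move=> /choice[h hh].
pose s := fix s i := if i is j.+1 then h (size (s j).1, i) else h (0%N, 0%N).
have hs i : [/\ qspan (range b) (s i).1, (s i).1 != 0,
    Y (s i).2 & `|phi (s i).1 - (s i).2| <= dl i * `|phi (s i).1|].
  by case: i => [|i] /=; [have [? ? _ ? ?] := hh (0%N, 0%N) | have [? ? _ ? ?] := hh (size (s i).1, i.+1)].
exists (fun i => (s i).1), (fun i => (s i).2); split=> [j|_ [i _ <-]|i|i].
- split; first by have [_ ? _ _] := hs j.
  by have [] := hh (size (s j).1, j.+1).
- by have [? _ _ _] := hs i.
- by have [_ _ ? _] := hs i.
- by have [_ _ _ ?] := hs i.
Qed.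

(** [follow] tests equivalence only at the end, whereas every node of the tree must satisfy it: the
    play is completed by zero vectors of I and then truncated. *)
Lemma follow_fin (K : nat) Y L xi xs ws : Y 0 -> size xs = size ws ->
  follow (eqv e K) Y L xi xs ws -> eqv e K xs ws.
Proof.
move=> Y0; elim: xi xs ws => [//|c IH|f IH] xs ws sxw /= h; last exact: (IH 0%N _ _ sxw (h 0%N)).
have [w [_ /IH hw]] := h 0 Y0; have {hw} := hw _; rewrite !size_rcons sxw => /(_ erefl).
rewrite /eqv !map_rcons -!cats1; apply: equivs_cat.
by rewrite !size_map.
Qed.

(** Copies are found in the span of a block sequence [l] close to vectors [u] of [Y], then the same
    combinations are formed with [u]. The induction therefore carries coefficient lists rather than
    vectors. *)
Theorem minimal_of_follow (b : nat -> qvec) a (K : nat) : block_seq b ->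
    (forall L, big L -> L `<=` qspan (range b) ->
       follow (eqv e K) (qspan (range b)) L a [::] [::]) ->
  beta_minimal (phi \o b) (BS a).
Proof.
move=> hb hfol z Y hz cY iY Yb; have [C [C1 hC]] := psum_le he.
have h2 : 0 < 2^-1 :> RR by rewrite invr_gt0.
have [z' [hz' z'b hzz']] := block_basis_approx_equivs he hb hz.
have [l [u [hl lb uY hlu]]] := almost_block_sequence hb (fun i => small_gt0 C1 i h2) cY iY Yb.
pose L := qspan (range l).
have Lb : L `<=` qspan (range b) by apply: qspan_least => //; exact: qspan_subspace.
have {hfol} hfol := hfol L (block_seq_big hl) Lb.
(* The factors come from [z] to [z'], from the game, and from [l] to [u]; adding 1 guarantees
   [1 <= K3] even for [K = 0]. *)
pose K3 : RR := 2 * K%:R * 2 + 1.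
have K31 : 1 <= K3 by have := ler0n RR K; rewrite /K3; lra.
have K30 : 0 < K3 by exact: lt_le_trans K31.
exists K3; split=> //.
pose wl c := comb c (mkseq l (size c)); pose ul c := rcomb c (mkseq u (size c)).
have hclose cs : equivs 2 (map phi (map wl cs)) (map ul cs).
  pose N := (\max_(c <- cs) size c)%N.
  have hN : all (fun c => size c <= N)%N cs.
    by apply/allP => c hc; rewrite /N (big_rem c hc) /= leq_maxl.
  have E1 : map phi (map wl cs) = [seq rcomb c (mkseq (phi \o l) N) | c <- cs].
    rewrite -map_comp; apply/eq_in_map => c /(allP hN) hc /=.
    rewrite /wl phi_comb; apply: eq_bigr => i _.
    by rewrite (nth_map 0) ?size_mkseq // !nth_mkseq // (leq_trans _ hc).
  have E2 : map ul cs = [seq rcomb c (mkseq u N) | c <- cs].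
    apply/eq_in_map => c /(allP hN) hc; apply: eq_bigr => i _.
    by rewrite !nth_mkseq // (leq_trans _ hc).
  rewrite E1 E2; apply: (equivs_close (ltW h2)) => // a0.
  have [d hd] := lincomb_map_rcomb W a0 cs.
  rewrite !hd ?size_mkseq // !lincomb_mkseq -sumrB; under eq_bigr do rewrite -scalerBr.
  have hp := perturb (d := fun i => phi (l i) - u i) C1 hC d (block_seq_blocked he hl) (ltW h2).
  by apply: hp => i _; exact: hlu.
have hT cs : eqv e K (mkseq z' (size cs)) (map wl cs) -> emb_tree z Y K3 (map ul cs).
  move=> hcs; split.
    move=> i; rewrite size_map => hi; rewrite (nth_map [::]) //.
    have [_ [Y0 sY]] := cY; rewrite /ul /rcomb; elim/big_ind: _ => // [v w Yv Yw|j _].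
      by rewrite -(scale1r v); exact: sY.
    rewrite nth_mkseq // -[X in Y X]addr0; exact: sY.
  apply/(equiv_KP _ _ K30) => a0; rewrite size_map.
  have : equivs (2 * K%:R * 2) (mkseq z (size cs)) (map ul cs).
    apply: (@equivs_trans _ _ 2 _ (map phi (map wl cs))) => //.
    apply: (@equivs_trans _ 2 K%:R _ (mkseq (phi \o z') (size cs))) => //.
    by move: hcs; rewrite /eqv /mkseq -!map_comp.
  move=> h; have h' : equivs K3 (mkseq z (size cs)) (map ul cs).
    by apply: equivs_le h; rewrite /K3 lerDl.
  by have [? ?] := h' a0.
suff claim xi cs : follow (eqv e K) (qspan (range b)) L xi (mkseq z' (size cs)) (map wl cs) ->
    rho_ge (emb_tree z Y K3) (map ul cs) xi by exact: (claim a [::]).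
elim: xi cs => [//|c IH|f IH] cs /= h; last by move=> k; exact: IH.
have [|w [Lw hw]] := h (z' (size cs)); first by apply: z'b; exists (size cs).
have [d Ed] := qspan_range_comb Lw.
have hw' : follow (eqv e K) (qspan (range b)) L c (mkseq z' (size (rcons cs d))) (map wl (rcons cs d)).
  by rewrite size_rcons mkseqS map_rcons /wl -Ed.
exists [:: ul d]; rewrite cats1 -map_rcons; split=> //; split; last exact: IH.
apply: hT; apply: follow_fin hw'; first exact: qspan0.
by rewrite size_mkseq size_map.
Qed.

End Minimal.

(** * Block bases and the dichotomy *)

Section BlockBasis.
Variables (W : completeNormedModType RR) (e : nat -> W) (he : schauder_basis e).

Lemma block_seq_block_basis x : block_seq x -> block_basis e (phi e \o x).
Proof.
move=> hx.
have bcut_ge n : (n <= block_start x n)%N by case: n => [|n] //=; exact: block_seq_size_ge.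
(* One coefficient sequence serves all blocks: supports are disjoint, and only blocks with [m <= i]
   can reach coordinate [i], so the sum has at most one nonzero term. *)
exists (block_start x), (fun i => ratr (\sum_(m < i.+1) (x m)`_i)) => n; split.
  by case: n => [|n] /=; [rewrite size_poly_gt0; exact: (hx _).1 | exact: block_seq_size_lt].
split; last by apply/eqP/(phi_neq0 he); exact: (hx n).1.
have tn : in_tail (block_start x n) (x n) by case: n => [|n] //; exact: (hx n).2.
rewrite /= /phi -(big_mkord xpredT (fun i => ratr (x n)`_i *: e i)).
have bs : (block_start x n <= size (x n))%N by case: n {tn} => //= n; apply: block_seq_size_le.
rewrite (big_cat_nat (leq0n _) bs) /= big_nat big1 ?add0r; last first.
  by move=> i /andP[_ hi]; rewrite tn // rmorph0 scale0r.
rewrite !big_nat; apply: eq_bigr => i /andP[ni isz]; congr (ratr _ *: _).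
have nlt : (n < i.+1)%N by rewrite ltnS; exact: leq_trans (bcut_ge n) ni.
rewrite (bigD1 (Ordinal nlt)) //= big1 ?addr0 // => m mn.
have : (m != n :> nat) by apply: contra mn => /eqP h; apply/eqP/val_inj.
rewrite neq_ltn => /orP[lt|lt]; last exact: (block_seq_in_tail hx lt).
rewrite nth_default //; apply: leq_trans ni.
by case: n lt {tn bs isz nlt mn} => //= n; rewrite ltnS; exact: block_seq_size_le.
Qed.

End BlockBasis.

Theorem theorem1p2 (W : completeNormedModType RR) (e : nat -> W)
  (he : schauder_basis e) (alpha : cord) :
  exists x : nat -> W, block_basis e x /\
    (beta_tight x (omega_mul alpha) \/ beta_minimal x (BS alpha)).
Proof.
have [[x [hx tx]]|hno] :=
    pselect (exists x, block_seq x /\ beta_tight (phi e \o x) (omega_mul alpha)).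
  by exists (phi e \o x); split; [exact: block_seq_block_basis | left].
(* Tightness now fails for every block sequence, in particular for the diagonal [x] produced after
   stabilization. *)
have [X [bX sX]] := exists_stable (eqv e) alpha.
have [x [hx xX dX]] := exists_diagonal bX sX.
have xsub : qspan (range x) `<=` X by apply: qspan_least => //; exact: bX.1.
have [y [K [d [hy yx hwin]]]] : exists y K d, [/\ block_seq y, range y `<=` qspan (range x) &
    basis_game (eqv e) y (qspan (range x)) K (omega_mul alpha) (mkseq x d) [::]].
  apply: contrapT => hn; apply: hno; exists x; split=> //.
  by apply: (tight_of_lost he) => // y K d hy yx hg; apply: hn; exists y, K, d.
have [K' hK'] := asym_drop_initial he d K hx.
have hM : asym (eqv e) (fun=> qspan (range y)) (qspan (range x)) K' alpha [::] [::] [::].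
  by apply: (@asym_basis_span _ y _ _ _ _ 0%N [::] [::]) => //; [exact: eqv_comb | exact: hK'].
have ysub : qspan (range y) `<=` qspan (range x).
  by apply: qspan_least => //; exact: qspan_subspace.
have hB : adv (eqv e) K' alpha X [::] [::] [::] [::].
  apply: (adv_mono (block_seq_big hx) bX (sub_almost_sub xsub)).
  exact: (asym_adv (block_seq_big hy) ysub _ hM).
exists (phi e \o y); split; [exact: block_seq_block_basis | right].
(* Two equivalences of constant [K'] are composed: from the vectors of I to the answers in the
   asymptotic game, and from these to the answers in [L]. *)
apply: (@minimal_of_follow _ _ he y alpha (K' * K')) => // L bL Ly.
apply: (@asym_adv_follow (eqv e) _ alpha X (qspan (range x)) _ L K' [::] [::] [::] [::] [::] [::]) => //.
- by move=> xs vs ws h1 h2; rewrite /eqv natrM; exact: equivs_trans h1 h2.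
- by move=> v /Ly/ysub/xsub.
Qed.
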